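(* Let $L>0$ be fixed and consider $\upsilon>0$ and $\omega>0$. For $\alpha>0$, set $$\mathcal{X}_\upsilon=\left\{u\in\mathbb{H}^1_{per,odd}:\ \int_0^L|u|^{\alpha+2}\,dx=\upsilon\right\},\qquad \mathcal{B}_\omega(u)=\frac12\int_0^L \left(|u_x|^2+\omega|u|^2\right)dx .$$ If $\alpha>0$ is an even integer, the minimization problem $$\Omega_\omega:=\inf_{u\in\mathcal{X}_\upsilon}\mathcal{B}_\omega(u)$$ has at least one solution, that is, there exists a complex-valued function $\Psi\in\mathcal{X}_\upsilon$ such that $\mathcal{B}_\omega(\Psi)=\Omega_\omega$. Moreover, $\Psi$ satisfies the equation $$-\Psi''+\omega\Psi-|\Psi|^\alpha\Psi=0 .$$
   Context: $H^1_{per}=H^1_{per}(\mathbb{T}_L)$ is the Sobolev space of real-valued $L$-periodic functions, $\mathbb{H}^1_{per}=H^1_{per}\times H^1_{per}$, where a pair $(f_1,f_2)$ is identified with the complex-valued function $f_1+if_2$, and $\mathbb{H}^1_{per,odd}$ is the subspace of odd functions in $\mathbb{H}^1_{per}$. $|\cdot|$ is the complex modulus.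
   Formalization: The equation for Ψ itself is claimed only when υ = 2Ω_ω, since integrating it against the conjugate of Ψ forces this; for every υ it is instead proved for κΨ, with κ>0, κ^α = 2Ω_ω/υ, which is a minimizer at level κ^(α+2)υ. *)

(* Defs.v *)
From HB Require Import structures.
From mathcomp Require Import all_boot all_order all_algebra.
From mathcomp Require Import all_classical all_reals all_analysis.
From mathcomp Require Import complex.

Set Implicit Arguments.
Unset Strict Implicit.
Unset Printing Implicit Defensive.

Import Order.TTheory GRing.Theory Num.Theory.
Import numFieldNormedType.Exports.

Local Open Scope classical_set_scope.
Local Open Scope ring_scope.
Local Open Scope complex_scope.

(* Functions on the torus T_L = R / LZ are encoded as L-periodic functions on
   the whole line, and integrated over [0, L]. *)

Section RealSobolev.
Context {R : realType}.
Implicit Types (L : R) (f g phi : R -> R).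

Definition L2per L f : Prop :=
  [/\ periodic f L, measurable_fun [set: R] f &
      lebesgue_measure.-integrable `[0, L] (fun x => (f x ^+ 2)%:E)].

Definition C1per L phi : Prop :=
  [/\ periodic phi L, forall x, derivable phi x 1 & continuous (derive1 phi)].

Definition weak_derivative L f g : Prop :=
  forall phi, C1per L phi ->
    \int[lebesgue_measure]_(x in `[0, L]) (f x * derive1 phi x) =
    - \int[lebesgue_measure]_(x in `[0, L]) (g x * phi x).

Definition H1per L f : Prop :=
  L2per L f /\ exists2 g, L2per L g & weak_derivative L f g.

(* The weak derivative is unique up to a.e. equality; [wderiv] picks one
   representative (and 0 when there is none). *)
Definition wderiv L f : R -> R :=
  xget (fun=> 0) [set g | L2per L g /\ weak_derivative L f g].

End RealSobolev.

Section ComplexSobolev.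
Context {R : realType}.
Implicit Types (L omega upsilon : R) (alpha : nat) (u : R -> R[i]).

(* The real-valued complex modulus: the ring norm on R[i] takes its values in
   R[i]. *)
Definition cmod (z : R[i]) : R := ComplexField.Normc.normc z.

Definition re_part u : R -> R := fun x => complex.Re (u x).
Definition im_part u : R -> R := fun x => complex.Im (u x).

Definition HH1per L u : Prop := H1per L (re_part u) /\ H1per L (im_part u).

(* Elements of the Sobolev space are classes modulo a.e. equality, hence so is
   oddness. *)
Definition HH1per_odd L u : Prop :=
  HH1per L u /\ {ae lebesgue_measure, forall x : R, u (- x) = - u x}.

Definition wderivC L u : R -> R[i] :=
  fun x => wderiv L (re_part u) x +i* wderiv L (im_part u) x.

Definition Xset L alpha upsilon : set (R -> R[i]) :=
  [set u | HH1per_odd L u /\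
     \int[lebesgue_measure]_(x in `[0, L]) (cmod (u x) ^+ (alpha + 2))
       = upsilon].

Definition Benergy L omega u : R :=
  2^-1 * \int[lebesgue_measure]_(x in `[0, L])
           (cmod (wderivC L u x) ^+ 2 + omega * cmod (u x) ^+ 2).

Definition Omega L alpha omega upsilon : R :=
  inf [set Benergy L omega u | u in Xset L alpha upsilon].

Definition is_minimizer L alpha omega upsilon u : Prop :=
  Xset L alpha upsilon u /\
  Benergy L omega u = Omega L alpha omega upsilon.

Definition derivableC u : Prop :=
  forall x, derivable (re_part u) x 1 /\ derivable (im_part u) x 1.

Definition deriveC u : R -> R[i] :=
  fun x => derive1 (re_part u) x +i* derive1 (im_part u) x.

Definition solves_equation alpha omega u : Prop :=
  [/\ derivableC u, derivableC (deriveC u) &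
      forall x, - deriveC (deriveC u) x + omega%:C * u x
                - (cmod (u x) ^+ alpha)%:C * u x = 0].

End ComplexSobolev.

(* Main.v *)
Require Import Defs.
From HB Require Import structures.
From mathcomp Require Import all_boot all_order all_algebra.
From mathcomp Require Import all_classical all_reals all_analysis.
From mathcomp Require Import measurable_realfun complex ring lra.

Import Order.TTheory GRing.Theory Num.Theory.
Import numFieldNormedType.Exports.

Local Open Scope ring_scope.
Local Open Scope complex_scope.

Set Implicit Arguments.
Unset Strict Implicit.
Unset Printing Implicit Defensive.

(** Why the minimization problem has a solution.

    Write alpha = 2 m and omega = s^2, and let G be the inverse of
    - d^2/dx^2 + s^2 on odd L-periodic functions ([green], given explicitly by
    variation of constants). Let Q be the quadratic form of the energy, so that
    Q (u) = 2 B (u), and for u in the constraint set put f = |u|^(2m) u,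
    v = G f and D (u) = Q (v), which is also the pairing of f with v.

    Two elementary inequalities replace weak compactness. First, upsilon is the
    pairing of f with u, which is the energy inner product of v and u, so that
    upsilon^2 <= D (u) Q (u) by Cauchy-Schwarz ([dual_form_lower_bound]). Secondly,
    by Young's inequality the multiple t v of v that lies in the constraint set
    satisfies Q (t v) <= upsilon^2 / D (u) ([improved_competitor]). Together they
    show that the passage from u to t v does not increase the energy, while it
    only depends on u through its values, not through its derivative.

    A Sobolev function on the circle has a continuous representative whose
    increments are the integrals of its weak derivative
    ([sobolev_representative], which rests on [fundamental_lemma]), so that a
    minimizing sequence is bounded and equicontinuous, and a subsequence converges
    to an odd periodic continuous u ([subsequence_of_equicontinuous]). The
    constraint and D are continuous along this subsequence, whence
    upsilon^2 <= 2 Omega D (u) ([extremal_pair]). The improved competitor w of u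
    then has energy at most 2 Omega: it is a minimizer, and it is smooth because G
    gains derivatives.

    The Euler-Lagrange equation comes for free. Both inequalities are equalities
    for the minimizer w, and equality in the Cauchy-Schwarz inequality means that
    G (|w|^(2m) w) is a multiple of w ([green_proportional]); the multiple is
    upsilon / (2 Omega). Applying - d^2/dx^2 + s^2 gives the equation with the
    Lagrange multiplier 2 Omega / upsilon, which is removed by rescaling
    ([rescaled_solution], [rescaled_minimizer]). *)

(** * Calculus of continuous functions on the line *)

Section Calculus.
Local Open Scope classical_set_scope.
Context {R : realType}.
Implicit Types (f g h : R -> R) (a b x y L : R).
Notation mu := (@lebesgue_measure R).
Local Notation "'intc' a b f" := (\int[mu]_(x in `[a, b]) f x)
  (at level 10, a, b, f at level 9).

Lemma is_derive_continuous f f' : (forall x, is_derive x 1 f (f' x)) -> continuous f.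
Proof.
move=> df x; apply: differentiable_continuous; apply/derivable1_diffP.
by have [] := df x.
Qed.

(** The rules of differentiation and continuity for functions given as
    lambda-terms, so that derivatives of compound expressions can be assembled
    as proof terms. *)
Lemma is_derive_mul f g (f' g' : R) x : is_derive x 1 f f' -> is_derive x 1 g g' ->
  is_derive x 1 (fun y => f y * g y) (f' * g x + f x * g').
Proof.
move=> df dg; have := is_deriveM df dg => dfg.
by apply: is_derive_eq; rewrite /GRing.scale/= addrC mulrC.
Qed.

Lemma is_derive_add f g (f' g' : R) x : is_derive x 1 f f' -> is_derive x 1 g g' ->
  is_derive x 1 (fun y => f y + g y) (f' + g').
Proof. by move=> df dg; exact: is_deriveD. Qed.

Lemma is_derive_sub f g (f' g' : R) x : is_derive x 1 f f' -> is_derive x 1 g g' ->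
  is_derive x 1 (fun y => f y - g y) (f' - g').
Proof. by move=> df dg; exact: is_deriveB. Qed.

Lemma is_derive_scale f (k f' : R) x : is_derive x 1 f f' ->
  is_derive x 1 (fun y => k * f y) (k * f').
Proof. by move=> df; exact: is_deriveZ. Qed.

Lemma is_derive_const (k : R) x : is_derive x 1 (fun=> k) 0.
Proof. exact: is_derive_cst. Qed.

Lemma is_derive_compose f g (f' g' : R) x : is_derive (g x) 1 f f' -> is_derive x 1 g g' ->
  is_derive x 1 (fun y => f (g y)) (f' * g').
Proof. by move=> df dg; exact: is_derive1_comp. Qed.

Lemma is_derive_affine f (f' k c : R) x : is_derive (k * x + c) 1 f f' ->
  is_derive x 1 (fun y => f (k * y + c)) (k * f').
Proof.
move=> df.
have dl : is_derive x 1 (fun y => k * y + c) (k * 1 + 0).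
  by apply: is_derive_add (is_derive_const _ _); apply: is_derive_scale;
    exact: is_derive_id.
have := @is_derive_compose f (fun y => k * y + c) f' (k * 1 + 0) x df dl.
by rewrite addr0 mulr1 mulrC.
Qed.

Lemma continuous_mul f g : continuous f -> continuous g -> continuous (fun x => f x * g x).
Proof. by move=> cf cg x; apply: cvgM; [exact: cf|exact: cg]. Qed.

Lemma continuous_add f g : continuous f -> continuous g -> continuous (fun x => f x + g x).
Proof. by move=> cf cg x; apply: cvgD; [exact: cf|exact: cg]. Qed.

Lemma continuous_sub f g : continuous f -> continuous g -> continuous (fun x => f x - g x).
Proof. by move=> cf cg x; apply: cvgB; [exact: cf|exact: cg]. Qed.

Lemma continuous_const (k : R) : continuous (fun _ : R => k).
Proof. by move=> x; exact: cvg_cst. Qed.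

Lemma continuous_pow f n : continuous f -> continuous (fun x => f x ^+ n).
Proof.
move=> cf; elim: n => [|n IH].
  by under eq_fun do rewrite expr0; exact: continuous_const.
by under eq_fun do rewrite exprS; exact: continuous_mul.
Qed.

Lemma continuous_compose f g : continuous f -> continuous g ->
  continuous (fun x => f (g x)).
Proof. by move=> cf cg x; apply: continuous_comp; [exact: cg|exact: cf]. Qed.

Lemma derive1_fun f f' : (forall x, is_derive x 1 f (f' x)) -> derive1 f = f'.
Proof. by move=> df; apply/funext => x; rewrite derive1E; have [_ ->] := df x. Qed.

Lemma continuous_integrable a b f : continuous f ->
  mu.-integrable `[a, b] (EFin \o f).
Proof.
move=> cf; apply: continuous_compact_integrable; first exact: segment_compact.
by apply: continuous_subspaceT => x; exact: cf.
Qed.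

Lemma continuous_bounded a b g : continuous g ->
  exists M : R, forall x, a <= x <= b -> `|g x| <= M.
Proof.
move=> cg.
have cg' : {within `[a, b], continuous g} by apply: continuous_subspaceT => x; exact: cg.
have /compact_bounded[M [_ gM]] := continuous_compact cg' (@segment_compact _ a b).
exists (M + 1) => x xab; apply: (gM (M + 1)); first by rewrite ltrDl.
by exists x => //=; rewrite in_itv.
Qed.

Lemma integrable_mul_continuous a b f g : mu.-integrable `[a, b] (EFin \o f) ->
  continuous g -> mu.-integrable `[a, b] (EFin \o (f \* g)).
Proof.
move=> fi cg.
have mf : measurable_fun `[a, b] f.
  by apply/measurable_EFinP; exact: measurable_int fi.
have mg : measurable_fun `[a, b] g.
  by apply: measurable_funTS; exact: continuous_measurable_fun.
have [M gM] := continuous_bounded a b cg.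
apply: (le_integrable _ _ _ (integrableZl _ M fi)) => //.
  by apply/measurable_EFinP; exact: measurable_funM.
move=> x /=; rewrite in_itv/= => xab; rewrite lee_fin !normrM mulrC ler_wpM2r//.
by rewrite (le_trans (gM x xab))// ler_norm.
Qed.

Lemma int_derivative f f' a b : (forall x, is_derive x 1 f (f' x)) -> continuous f' ->
  a <= b -> intc a b f' = f b - f a.
Proof.
move=> df cf'; rewrite le_eqVlt => /predU1P[<-|ab].
  by rewrite set_itv1 Rintegral_set1 subrr.
rewrite /Rintegral (@continuous_FTC2 _ f' f)//.
- by apply: continuous_subspaceT => x; exact: cf'.
- split.
  + by move=> x _; have [] := df x.
  + by apply: cvg_at_right_filter; exact: (is_derive_continuous df).
  + by apply: cvg_at_left_filter; exact: (is_derive_continuous df).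
- by move=> x _; rewrite derive1E; have [_ ->] := df x.
Qed.

(** The oriented integral from 0 to x, for either sign of x. The base point
    - (|x| + 1) lies to the left of both 0 and x, and it cancels in the
    difference. *)
Definition primitive f x : R := intc (- (`|x| + 1)) x f - intc (- (`|x| + 1)) 0 f.

(** The moving base point of [primitive] can be replaced by a fixed one in a
    neighbourhood of x, where the fundamental theorem of calculus applies. *)
Lemma is_derive_primitive f : continuous f -> forall x, is_derive x 1 (primitive f) (f x).
Proof.
move=> cf x.
pose N := `|x| + 2%:R.
pose F y := intc (- N) y f.
have xN : - N < x < N.
  by rewrite -ltr_norml /N ltrDl ltr0n.
have dF y : - N < y < N -> is_derive y 1 F (f y).
  move=> /andP[y1 y2].
  have [dFx Fx] := @continuous_FTC1_closed R f (- N) y N y2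
    (@continuous_integrable (- N) N _ cf) y1 (cf y).
  by apply: DeriveDef => //; rewrite -derive1E.
have shift c d y : c <= d -> d <= y -> intc c y f - intc d y f = intc c d f.
  move=> cd dy.
  have := @Rintegral_itvB R f (BLeft c) (BRight y) d (@continuous_integrable c y _ cf).
  rewrite !bnd_simp => /(_ cd dy) E.
  rewrite -(@Rintegral_itv_obnd_cbnd _ d (BRight y)) -?E; first by ring.
  apply: integrableS (@continuous_integrable d y _ cf) => //.
  by apply: subset_itvr; rewrite bnd_simp.
have primitiveE : \forall y \near x, F y - F 0 = primitive f y.
  near=> y.
  have yx : `|x - y| < 1.
    by near: y; apply: (@cvgr_dist_lt _ _ _ (nbhs x) _ id x) => //; exact: cvg_id.
  have yN : `|y| + 1 <= N.
    have := lerB_dist y x; rewrite distrC /N => h.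
    by have := le_lt_trans h yx; lra.
  have y1 : - (`|y| + 1) <= y by rewrite lerNl; apply: le_trans (ler_norm _) _;
    rewrite normrN lerDl.
  rewrite /primitive /F.
  have yN' : - N <= - (`|y| + 1) by rewrite lerN2.
  have := shift _ _ _ yN' y1.
  have : - (`|y| + 1) <= 0 by rewrite oppr_le0 addr_ge0.
  move/(shift _ _ _ yN'); lra.
have /= dF' := @is_deriveB _ _ _ _ _ _ _ _ _ (dF x xN) (is_derive_cst (F 0) x 1).
rewrite subr0 in dF'.
apply: near_eq_is_derive primitiveE _ => //; exact: dF'.
Unshelve. all: by end_near. Qed.

Lemma primitive0 f : primitive f 0 = 0.
Proof. by rewrite /primitive subrr. Qed.

Lemma primitiveE f x : continuous f -> 0 <= x -> primitive f x = intc 0 x f.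
Proof.
by move=> cf x0; rewrite (int_derivative (is_derive_primitive cf))// primitive0 subr0.
Qed.

Lemma eq_fun_of_derive f g (f' : R -> R) : f 0 = g 0 ->
  (forall x, is_derive x 1 f (f' x)) -> (forall x, is_derive x 1 g (f' x)) -> f =1 g.
Proof.
move=> fg0 df dg x; apply/eqP; rewrite -subr_eq0; apply/eqP.
transitivity ((f - g) 0); last by rewrite fctE fg0 subrr.
apply: (@is_derive_0_is_cst R (f - g) x 0) => y.
by have dfy := df y; have dgy := dg y; apply: is_derive_eq; rewrite subrr.
Qed.

Lemma ae_imp3 (P Q S U : R -> Prop) : (forall x, P x -> Q x -> S x -> U x) ->
  {ae mu, forall x, P x} -> {ae mu, forall x, Q x} -> {ae mu, forall x, S x} ->
  {ae mu, forall x, U x}.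
Proof.
move=> PQSU aP aQ aS.
exact: (@filterS3 _ _ (ae_filter_ringOfSetsType mu) _ _ _ _ PQSU).
Qed.

Lemma ae_imp (P U : R -> Prop) : (forall x, P x -> U x) ->
  {ae mu, forall x, P x} -> {ae mu, forall x, U x}.
Proof. by move=> PU aP; apply: (ae_imp3 _ aP aP aP) => x Px _ _; exact: PU. Qed.

Lemma ae_imp2 (P Q U : R -> Prop) : (forall x, P x -> Q x -> U x) ->
  {ae mu, forall x, P x} -> {ae mu, forall x, Q x} -> {ae mu, forall x, U x}.
Proof. by move=> PQU aP aQ; apply: (ae_imp3 _ aP aQ aQ) => x Px Qx _; exact: PQU. Qed.

Lemma ae_neq (c : R) : {ae mu, forall x, x != c}.
Proof.
exists [set c]; split=> //; first exact: lebesgue_measure_set1.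
by move=> x /=; case: eqVneq.
Qed.

End Calculus.

(** * The fundamental lemma of the calculus of variations on the torus *)

Section FundamentalLemma.
Local Open Scope classical_set_scope.
Context {R : realType}.
Implicit Types (f g h : R -> R) (a b x y L : R).
Notation mu := (@lebesgue_measure R).
Local Notation "'intc' a b f" := (\int[mu]_(x in `[a, b]) f x)
  (at level 10, a, b, f at level 9).
Lemma dominated_cvg_mul a b h (p_ : nat -> R -> R) (p : R -> R) (M : R) :
  mu.-integrable `[a, b] (EFin \o h) -> (forall n, continuous (p_ n)) ->
  (forall n x, a <= x <= b -> `|p_ n x| <= M) ->
  (forall x, a <= x <= b -> p_ n x @[n --> \oo] --> p x) ->
  intc a b (h \* p_ n) @[n --> \oo] --> intc a b (h \* p).
Proof.
move=> hi cp pM pp.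
have mh : measurable_fun `[a, b] h.
  by apply/measurable_EFinP; exact: measurable_int hi.
have mp n : measurable_fun `[a, b] (p_ n).
  by apply: measurable_funTS; exact: continuous_measurable_fun.
have mp' : measurable_fun `[a, b] p.
  by apply: (@measurable_fun_cvg _ _ R `[a, b] p_).
have hpp x : `[a, b] x -> (EFin \o (h \* p_ n)) x @[n --> \oo] --> (EFin \o (h \* p)) x.
  rewrite /= in_itv/= => xab; apply: cvg_EFin; first by apply: nearW.
  by apply: cvgM; [exact: cvg_cst|exact: pp].
have gi : mu.-integrable `[a, b] (fun x => (M%:E * `|(EFin \o h) x|)%E).
  by apply: integrableZl => //; exact: integrable_abse.
have hg n x : `[a, b] x -> (`|(h x * p_ n x)%R%:E| <= M%:E * `|(EFin \o h) x|)%E.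
  rewrite /= in_itv/= => xab; rewrite lee_fin normrM mulrC ler_wpM2r//.
  exact: pM.
have [|||||hpi _ cv] := @dominated_convergence _ _ R mu `[a, b] _
  (fun n => EFin \o (h \* p_ n)) (EFin \o (h \* p)) _ _ _ _ gi.
- by [].
- by move=> n; apply/measurable_EFinP; exact: (measurable_funM mh (mp n)).
- by apply/measurable_EFinP; exact: (measurable_funM mh mp').
- by apply: aeW => x; exact: hpp.
- by apply: aeW => x n; exact: hg.
have hpf : (\int[mu]_(x in `[a, b]) ((h \* p)%R x)%:E)%E = (intc a b (h \* p))%:E.
  by rewrite fineK//; exact: integrable_fin_num.
by move: cv; rewrite /= hpf => /fine_cvgP[].
Qed.

(** Both factors change sign under the shift by L, so that the product is
    L-periodic without any gluing; on [0, L] it is positive exactly on (0, b). *)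
Definition bump L b x : R := sin (pi / L * x) * sin (pi / L * (b - x)).

(** A smooth step with values in [0, 1]. As k grows it tends to 1 for x > 0,
    and to 0 for x <= 0 including x = 0. *)
Definition soft_step (k : R) x : R := expR (- k * expR (- k * x)).

Lemma bump_C1per L b k : 0 < L -> C1per L (soft_step k \o bump L b).
Proof.
move=> L0.
have L0' : pi / L * L = pi :> R by field; rewrite gt_eqF.
set c : R := pi / L in L0'.
have dq x : is_derive x 1 (bump L b)
    (c * cos (c * x + 0) * sin (- c * x + c * b) + sin (c * x +
      0) * (- c * cos (- c * x + c * b))).
  rewrite (_ : bump L b = fun y => sin (c * y + 0) * sin (- c * y + c * b)); last first.
    by apply/funext => y; rewrite /bump -/c addr0 mulrBr addrC mulNr.
  by apply: is_derive_mul; apply: is_derive_affine; exact: is_derive_sin.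
have dE x := @is_derive_compose R expR _ _ _ _ (is_derive_expR _)
  (is_derive_scale (- k) (dq x)).
have dF x := @is_derive_compose R expR _ _ _ _ (is_derive_expR _)
  (is_derive_scale (- k) (dE x)).
have cos_aff d e : continuous (fun x : R => cos (d * x + e)).
  by apply: is_derive_continuous => x; apply: is_derive_affine; exact: is_derive_cos.
have sin_aff d e : continuous (fun x : R => sin (d * x + e)).
  by apply: is_derive_continuous => x; apply: is_derive_affine; exact: is_derive_sin.
split.
- move=> x; congr soft_step; rewrite /bump -/c.
  rewrite (_ : c * (x + L) = c * x + pi); last by rewrite mulrDr L0'.
  rewrite (_ : c * (b - x) = c * (b - (x + L)) + pi); last by rewrite -L0'; ring.
  by rewrite !sinDpi mulrN mulNr.
- by move=> x; have [] := dF x.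
- rewrite (derive1_fun dF).
  do ![apply: continuous_mul | apply: continuous_add | apply: continuous_const | exact:
    cos_aff | exact: sin_aff].
  + exact: is_derive_continuous dF.
  + exact: is_derive_continuous dE.
Qed.

Lemma soft_step_le1 (k q : R) : 0 <= k -> `|soft_step k q| <= 1.
Proof.
move=> k0; rewrite /soft_step ger0_norm ?expR_ge0// -expR0 ler_expR.
by rewrite mulNr oppr_le0 mulr_ge0// expR_ge0.
Qed.

(** The inner term k exp (- k q) is at most a constant times 1 / (k + 1), because the
    exponential dominates the square. *)
Lemma cvg_soft_step_pos (q : R) : 0 < q -> soft_step n%:R q @[n --> \oo] --> (1 : R).
Proof.
move=> q0.
have C0 : 0 < 4 / q ^+ 2 by rewrite divr_gt0// exprn_gt0.
have cvg0 : n%:R * expR (- n%:R * q) @[n --> \oo] --> (0 : R).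
  apply: (@squeeze_cvgr _ _ _ _ (fun=> 0) (fun n => 4 / q ^+ 2 * n.+1%:R^-1)); last 2 first.
  - exact: cvg_cst.
  - by rewrite -[X in _ --> X](mulr0 (4 / q ^+ 2)); apply: cvgM;
    [exact: cvg_cst|exact: cvg_harmonic].
  apply: nearW => n; rewrite mulr_ge0//= ?expR_ge0//.
  rewrite mulNr expRN ler_pdivrMr ?expR_gt0// mulrAC ler_pdivlMr ?ltr0Sn//.
  have t0 : 0 <= (n%:R : R) <= n%:R ^+ 2.
    by rewrite ler0n/= -natrX ler_nat; case: n => // n; rewrite expnS leq_pmulr// expn_gt0.
  have E1 := @expR_ge1Dxn R (n%:R * q) 1 (mulr_ge0 (ler0n _ _) (ltW q0)).
  apply: (@le_trans _ _ (4 / q ^+ 2 * (1 + (n%:R * q) ^+ 2 / 2))); last first.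
    by rewrite ler_pM2l// (le_trans _ E1)// expr2 /= !factS fact0.
  have -> : 4 / q ^+ 2 * (1 + (n%:R * q) ^+ 2 / 2) = 4 / q ^+ 2 + 2 * n%:R ^+ 2.
    by field; rewrite gt_eqF.
  by rewrite -natr1; move: C0 t0; nra.
rewrite /soft_step; under eq_fun do rewrite mulNr.
have : expR (- (n%:R * expR (- n%:R * q))) @[n --> \oo] --> expR (- (0 : R)).
  by apply: continuous_cvg; [exact: continuous_expR|exact: cvgN].
by rewrite oppr0 expR0.
Qed.

Lemma cvg_soft_step_neg (q : R) : q <= 0 -> soft_step n%:R q @[n --> \oo] --> (0 : R).
Proof.
move=> q0.
apply: (@squeeze_cvgr _ _ _ _ (fun=> 0) (fun n => n.+1%:R^-1)); last 2 first.
- exact: cvg_cst.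
- exact: cvg_harmonic.
apply: nearW => n; rewrite expR_ge0/= /soft_step mulNr expRN lef_pV2 ?posrE ?expR_gt0
  ?ltr0Sn//.
apply: le_trans (expR_ge1Dx _).
rewrite -natr1 addrC lerD2l ler_peMr// -expR0 ler_expR.
by rewrite mulNr -mulrN mulr_ge0// oppr_ge0.
Qed.

Lemma bump_gt0 L b x : 0 < L -> 0 < x < b -> b <= L -> 0 < bump L b x.
Proof.
move=> L0 /andP[x0 xb] bL; rewrite /bump.
have c0 : 0 < pi / L :> R by rewrite divr_gt0// pi_gt0.
have E : pi / L * L = pi :> R by field; rewrite gt_eqF.
rewrite mulr_gt0//; apply: sin_gt0_pi; rewrite mulr_gt0 ?subr_gt0//= -[ltRHS]E
  ltr_pM2l//; lra.
Qed.

Lemma bump_le0 L b x : 0 < L -> 0 < b <= L -> b <= x <= L -> bump L b x <= 0.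
Proof.
move=> L0 /andP[b0 bL] /andP[bx xL]; rewrite /bump.
have c0 : 0 < pi / L :> R by rewrite divr_gt0// pi_gt0.
have E : pi / L * L = pi :> R by field; rewrite gt_eqF.
rewrite -[b - x]opprB mulrN sinN mulrN oppr_le0 mulr_ge0//; apply: sin_ge0_pi;
  rewrite mulr_ge0 ?(ltW c0)//= ?subr_ge0// -?[leRHS]E ?ler_pM2l//; lra.
Qed.

(** The test functions soft_step k o bump tend boundedly to the indicator of
    (0, b). *)
Lemma initial_integral_eq0 L h b : 0 < L -> mu.-integrable `[0, L] (EFin \o h) ->
  (forall phi, C1per L phi -> intc 0 L (fun x => h x * phi x) = 0) ->
  0 < b <= L -> intc 0 b h = 0.
Proof.
move=> L0 hi h0 /andP[b0 bL].
pose p_ n := soft_step n%:R \o bump L b.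
pose p := \1_(`]0, b[%classic : set R) : R -> R.
have cp n : continuous (p_ n).
  have [_ dp _] := bump_C1per b n%:R L0.
  by move=> x; apply: differentiable_continuous; apply/derivable1_diffP; exact: dp.
have cv : intc 0 L (h \* p_ n) @[n --> \oo] --> intc 0 L (h \* p).
  apply: (@dominated_cvg_mul 0 L h p_ p 1 hi cp) => [n x _|x /andP[x0 xL]].
    by apply: soft_step_le1; exact: ler0n.
  rewrite /p indicE /p_ /=; have [xb|xb] := boolP (x \in (`]0, b[%classic : set R)).
    move: xb; rewrite inE/= in_itv/= => xb.
    by apply: cvg_soft_step_pos; exact: bump_gt0.
  apply: cvg_soft_step_neg.
  have [->|x0'] := eqVneq x 0; first by rewrite /bump mulr0 sin0 mul0r.
  apply: bump_le0 => //; first by rewrite b0.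
  rewrite xL andbT leNgt; apply/negP => xb'; case/negP: xb.
  by rewrite inE/= in_itv/= lt0r x0' x0.
have cv0 : intc 0 L (h \* p_ n) @[n --> \oo] --> (0 : R).
  by under eq_fun do rewrite (h0 _ (bump_C1per b _ L0)); exact: cvg_cst.
have : intc 0 L (h \* p) = 0 by exact: (cvg_unique (@Rhausdorff R) cv cv0).
rewrite (@eq_Rintegral _ _ _ mu _ (h \_ `]0, b[)); last first.
  by move=> x _; rewrite patchE /= /p indicE; case: (x \in _); rewrite ?mulr1 ?mulr0.
have sub : `]0, b[ `<=` `[0, L].
  by move=> x; rewrite /= !in_itv/= => /andP[x0 xb]; apply/andP; split; lra.
rewrite -Rintegral_mkcondr setIC (setIidl sub).
rewrite Rintegral_itv_obnd_cbnd; last exact: integrableS hi.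
rewrite Rintegral_itv_bndo_bndc//.
apply: integrableS hi => //.
by move=> x; rewrite /= !in_itv/= => /andP[x0 xb]; apply/andP; split; lra.
Qed.

(** The primitive of h vanishes on (0, L), hence so does h at each of its
    Lebesgue points, where h is the derivative of this primitive. *)
Lemma fundamental_lemma L h : 0 < L -> mu.-integrable `[0, L] (EFin \o h) ->
  (forall phi, C1per L phi -> intc 0 L (fun x => h x * phi x) = 0) ->
  {ae mu, forall x, 0 <= x <= L -> h x = 0}.
Proof.
move=> L0 hi h0.
pose k := h \_ `[0, L].
have ki : mu.-integrable [set: R] (EFin \o k).
  by rewrite /k -restrict_EFin; apply/integrable_restrict => //=; rewrite setTI.
have kloc : locally_integrable [set: R] k by exact: integrable_locally.
have F0 y : 0 < y < L -> intc 0 y k = 0.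
  move=> /andP[y0 yL]; rewrite (@eq_Rintegral _ _ _ mu _ h).
    by apply: (initial_integral_eq0 L0 hi h0); rewrite y0 ltW.
  move=> x; rewrite inE/= in_itv/= => /andP[x0 xy].
  by rewrite /k patchE mem_set//= in_itv/= x0 (le_trans xy)// ltW.
have kiy y : mu.-integrable [set` Interval (BLeft 0) (BRight y)] (EFin \o k).
  exact: integrableS ki.
have /= aeF := FTC1 kiy kloc.
apply: (ae_imp3 _ (ae_neq 0) (ae_neq L) aeF) => x x0 xL FTCx /andP[x0' xL'].
have x0L : 0 < x < L by rewrite !lt_neqAle eq_sym x0 x0' xL xL'.
have [|dF] := FTCx; first by case/andP: x0L => x0L _; rewrite lte_fin.
rewrite /k patchE mem_set/=; last by rewrite in_itv/= x0'.
move=> <-; apply/eqP; rewrite eq_sym; apply/eqP.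
have near0 : \forall y \near x, cst 0 y = intc 0 y k.
  have : \forall y \near x, y \in `]0, L[%R by apply: near_in_itvoo; rewrite in_itv/=.
  by apply: filterS => y; rewrite in_itv/= => /F0 ->.
have [_] := near_eq_is_derive near0 (is_derive_cst (0 : R) x (1 : R)).
by rewrite -derive1E => ->.
Qed.

End FundamentalLemma.

(** * Square-integrable periodic functions and their weak derivatives *)

Section SquareIntegrable.
Local Open Scope classical_set_scope.
Context {R : realType}.
Implicit Types (f g h : R -> R) (a b x y L : R).
Notation mu := (@lebesgue_measure R).
Local Notation "'intc' a b f" := (\int[mu]_(x in `[a, b]) f x)
  (at level 10, a, b, f at level 9).
Lemma int_split a b c f : mu.-integrable `[a, c] (EFin \o f) -> a <= b -> b <= c ->
  intc a c f = intc a b f + intc b c f.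
Proof.
move=> fi ab bc.
have := @Rintegral_itvB R f (BLeft a) (BRight c) b fi.
rewrite !bnd_simp => /(_ ab bc).
rewrite Rintegral_itv_obnd_cbnd; first by move=> <-; rewrite addrC subrK.
apply: integrableS fi => //.
by move=> x; rewrite /= !in_itv/= => /andP[x0 xb]; apply/andP; split; lra.
Qed.

Lemma integrable_subitv a b c d f : mu.-integrable `[a, d] (EFin \o f) ->
  a <= b -> c <= d -> mu.-integrable `[b, c] (EFin \o f).
Proof.
move=> fi ab cd; apply: integrableS fi => //.
by move=> x; rewrite /= !in_itv/= => /andP[x0 xb]; apply/andP; split; lra.
Qed.

Lemma integrable_cst a b (k : R) : mu.-integrable `[a, b] (EFin \o (fun=> k)).
Proof. by apply: continuous_integrable; exact: continuous_const. Qed.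

Lemma int_cst a b (k : R) : a <= b -> intc a b (fun=> k) = k * (b - a).
Proof.
move=> ab; rewrite Rintegral_cst//= lebesgue_measure_itv/=.
case: ifP; rewrite lte_fin.
  by rewrite -EFinB.
by move/negbT; rewrite -leNgt => ba; rewrite (@le_anti _ _ a b) ?ab ?ba// subrr mulr0.
Qed.

Section L2.
Variables (L : R) (f g : R -> R).
Hypotheses (Lf : L2per L f) (Lg : L2per L g).

Lemma L2per_integrable_mul : mu.-integrable `[0, L] (EFin \o (fun x => f x * g x)).
Proof.
have [_ mf f2] := Lf; have [_ mg g2] := Lg.
apply: (le_integrable _ _ _ (integrableD _ f2 g2)) => //.
  apply/measurable_EFinP; apply: measurable_funTS.
  exact: (measurable_funM mf mg).
move=> x _ /=; rewrite lee_fin.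
by rewrite [leRHS]ger0_norm ?addr_ge0 ?sqr_ge0// normrM;
  rewrite -(real_normK (num_real (f x))) -(real_normK (num_real (g x))); nra.
Qed.

Lemma L2per_integrable : mu.-integrable `[0, L] (EFin \o f).
Proof.
have [_ mf f2] := Lf.
apply: (le_integrable _ _ _ (integrableD _ f2 (integrable_cst 0 L 1))) => //.
  by apply/measurable_EFinP; apply: measurable_funTS.
move=> x _ /=; rewrite lee_fin [leRHS]ger0_norm ?addr_ge0 ?sqr_ge0//.
by rewrite -(real_normK (num_real (f x))); have := normr_ge0 (f x); nra.
Qed.

End L2.

(** The difference of two weak derivatives is orthogonal to all test functions. *)
Lemma weak_derivative_unique L f g1 g2 : 0 < L -> L2per L g1 -> L2per L g2 ->
  weak_derivative L f g1 -> weak_derivative L f g2 ->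
  {ae mu, forall x, 0 <= x <= L -> g1 x = g2 x}.
Proof.
move=> L0 L1 L2 w1 w2.
have i1 := L2per_integrable L1; have i2 := L2per_integrable L2.
suff : {ae mu, forall x, 0 <= x <= L -> (g1 \- g2) x = 0}.
  by apply: ae_imp => x E /E/eqP; rewrite /= subr_eq0 => /eqP.
apply: (fundamental_lemma L0); first exact: (integrableB _ i1 i2).
move=> phi C1phi.
have cphi : continuous phi.
  have [_ dphi _] := C1phi.
  by move=> x; apply: differentiable_continuous; apply/derivable1_diffP; exact: dphi.
rewrite (@eq_Rintegral _ _ _ mu _ (fun x => g1 x * phi x - g2 x * phi x)); last first.
  by move=> x _; rewrite /= mulrBl.
rewrite RintegralB//; [|exact: integrable_mul_continuous|exact: integrable_mul_continuous].
by apply/eqP; rewrite subr_eq0 -eqr_opp -w1// w2.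
Qed.

(** The modulus depends on g only through the bound M for its L^2 norm: this is
    what makes sequences of bounded energy equicontinuous. Integrating
    2 l |g| <= l^2 + g^2 plays the role of the Cauchy-Schwarz inequality. *)
Lemma equicontinuity L g (M eps : R) x y : L2per L g -> intc 0 L (fun t => g t ^+ 2) <= M ->
  0 < eps -> 0 <= x -> x <= y -> y <= L -> y - x <= eps ^+ 2 / (M + 1) ->
  `|intc x y g| <= eps.
Proof.
move=> Lg gM e0 x0 xy yL yx.
have [_ mg g2] := Lg.
have M0 : 0 <= M by apply: le_trans gM; apply: Rintegral_ge0 => t _; exact: sqr_ge0.
have gi := integrable_subitv (L2per_integrable Lg) x0 yL.
have g2i : mu.-integrable `[x, y] (EFin \o (fun t => g t ^+ 2))
  by exact: integrable_subitv g2 x0 yL.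
(* The weight l balances the two terms at eps / 2 each; M + 1 avoids a division
   by zero. *)
pose l := (M + 1) / eps.
have l0 : 0 < l by rewrite divr_gt0//; lra.
have g2l : mu.-integrable `[x, y] (EFin \o (fun t => (2 * l)^-1 * g t ^+ 2)).
  by apply: (@integrableZl _ _ _ mu _ _ (2 * l)^-1 (EFin \o (fun t => g t ^+ 2))).
apply: le_trans (le_normr_Rintegral _ gi) _ => //.
apply: (@le_trans _ _ (intc x y (fun t => l / 2 + (2 * l)^-1 * g t ^+ 2))).
  apply: le_Rintegral => //; first exact: (integrable_abse gi).
    by apply: (integrableD _ (integrable_cst _ _ (l / 2)) g2l).
  move=> t _; rewrite -(real_normK (num_real (g t))).
  have : 0 <= (l - `|g t|) ^+ 2 / (2 * l) by rewrite divr_ge0 ?sqr_ge0// mulr_ge0// ltW.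
  rewrite (_ : (l - _) ^+ 2 / _ = l / 2 + (2 * l)^-1 * `|g t| ^+ 2 - `|g t|); first lra.
  by field; rewrite gt_eqF.
rewrite RintegralD//; last exact: integrable_cst.
rewrite int_cst// RintegralZl//.
set I := (X in _ + _ * X <= _).
have IM : I <= M.
  rewrite /I; apply: le_trans gM.
  have xL : x <= L by lra.
  rewrite (int_split g2 x0 xL) (int_split (integrable_subitv g2 x0 (lexx L)) xy yL).
  have p0 c d : 0 <= intc c d (fun t => g t ^+ 2) by apply: Rintegral_ge0 => t _;
    exact: sqr_ge0.
  by rewrite addrCA lerDl addr_ge0.
have I0 : 0 <= I by apply: Rintegral_ge0 => t _; exact: sqr_ge0.
clearbody I.
have E1 : l / 2 * (y - x) <= eps / 2.
  rewrite (_ : eps / 2 = l / 2 * (eps ^+ 2 / (M + 1)));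
    first by rewrite ler_pM2l// divr_gt0.
  by rewrite /l; field; rewrite !gt_eqF//; lra.
have E2 : (2 * l)^-1 * I <= eps / 2.
  rewrite (_ : (2 * l)^-1 * I = eps / 2 * (I / (M + 1))); last first.
    by rewrite /l; field; rewrite !gt_eqF//; lra.
  rewrite ger_pMr ?divr_gt0// ler_pdivrMr; lra.
lra.
Qed.

End SquareIntegrable.

(** * Integration by parts for primitives of integrable functions *)

Section IntegrationByParts.
Local Open Scope classical_set_scope.
Context {R : realType}.
Implicit Types (f g h : R -> R) (a b x y L : R).
Notation mu := (@lebesgue_measure R).
Local Notation "'intc' a b f" := (\int[mu]_(x in `[a, b]) f x)
  (at level 10, a, b, f at level 9).

Section AbsolutelyContinuousParts.
Variables (L : R) (psi psi' : R -> R) (A : R).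
Hypotheses (L0 : 0 < L) (dpsi : forall x, is_derive x 1 psi (psi' x)).
Hypotheses (cpsi' : continuous psi').
Hypotheses (psiA : forall x, 0 <= x <= L -> `|psi x| <= A)
  (psi'A : forall x, 0 <= x <= L -> `|psi' x| <= A).

(** The defect in the integration by parts formula. It is linear in h, vanishes
    for continuous h and is bounded by the L^1 norm of h, so that the density of
    continuous functions in L^1 makes it vanish for every integrable h. *)
Let E h := intc 0 L (fun x => intc 0 x h * psi' x) + intc 0 L (fun x => h x * psi x)
   - intc 0 L h * psi L.

Let cpsi : continuous psi. Proof. exact: is_derive_continuous dpsi. Qed.

Lemma primitive_integrable h : mu.-integrable `[0, L] (EFin \o h) ->
  mu.-integrable `[0, L] (EFin \o (fun x => intc 0 x h)).
Proof.
move=> hi; apply: continuous_compact_integrable; first exact: segment_compact.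
exact: (parameterized_integral_continuous (ltW L0) hi).
Qed.

Let E_continuous h : continuous h -> E h = 0.
Proof.
move=> ch; rewrite /E.
have dP := is_derive_primitive ch.
have dPpsi x := is_derive_mul (dP x) (dpsi x).
have cP : continuous (primitive h) by exact: is_derive_continuous dP.
have := int_derivative dPpsi (continuous_add (continuous_mul ch cpsi)
  (continuous_mul cP cpsi')) (ltW L0).
rewrite primitive0 mul0r subr0 (primitiveE ch (ltW L0)) => <-.
rewrite RintegralD//; [|exact: continuous_integrable (continuous_mul ch cpsi)|
  exact: continuous_integrable (continuous_mul cP cpsi')].
apply/eqP; rewrite subr_eq0 addrC; apply/eqP; congr (_ + _).
apply: eq_Rintegral => x; rewrite inE/= in_itv/= => /andP[x0 _].
by rewrite primitiveE.
Qed.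

Let E_sub h k : mu.-integrable `[0, L] (EFin \o h) -> mu.-integrable `[0, L] (EFin \o k) ->
  E (h \- k) = E h - E k.
Proof.
move=> hi ki; rewrite /E.
have Ehk x : 0 <= x <= L -> intc 0 x (h \- k) = intc 0 x h - intc 0 x k.
  by move=> /andP[x0 xL]; rewrite RintegralB//; [exact: integrable_subitv hi _ xL|
    exact: integrable_subitv ki _ xL].
rewrite (Ehk L) ?lexx ?ltW//.
have -> : intc 0 L (fun x => intc 0 x (h \- k) * psi' x) =
    intc 0 L (fun x => intc 0 x h * psi' x - intc 0 x k * psi' x).
  by apply: eq_Rintegral => x; rewrite inE/= in_itv/= => /Ehk ->; rewrite mulrBl.
rewrite RintegralB//; [|exact: integrable_mul_continuous (primitive_integrable hi) _|
  exact: integrable_mul_continuous (primitive_integrable ki) _].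
have -> : intc 0 L (fun x => (h \- k) x * psi x) = intc 0 L
  (fun x => h x * psi x - k x * psi x).
  by apply: eq_Rintegral => x _; rewrite /= mulrBl.
rewrite RintegralB//; [|exact: integrable_mul_continuous|exact: integrable_mul_continuous].
ring.
Qed.

Let E_bound h : mu.-integrable `[0, L] (EFin \o h) ->
  `|E h| <= A * (L + 2) * intc 0 L (fun x => `|h x|).
Proof.
move=> hi; rewrite /E.
have hai : mu.-integrable `[0, L] (EFin \o (fun x => `|h x|))
  by exact: (integrable_abse hi).
set N := intc 0 L (fun x => `|h x|).
have A0 : 0 <= A.
  by have := psiA (x := 0); rewrite lexx ltW//= => /(_ isT); exact: le_trans.
have N0 : 0 <= N by apply: Rintegral_ge0.
have FN x : 0 <= x <= L -> `|intc 0 x h| <= N.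
  move=> /andP[x0 xL].
  have hix := integrable_subitv hi (lexx 0) xL.
  apply: le_trans (le_normr_Rintegral _ hix) _ => //.
  rewrite /N (int_split hai x0 xL) lerDl; exact: Rintegral_ge0.
have b1 : `|intc 0 L (fun x => intc 0 x h * psi' x)| <= A * L * N.
  have i1 := integrable_mul_continuous (primitive_integrable hi) cpsi'.
  apply: le_trans (le_normr_Rintegral _ i1) _ => //.
  apply: (@le_trans _ _ (intc 0 L (fun=> N * A))).
    apply: le_Rintegral => //; first exact: (integrable_abse i1).
      exact: integrable_cst.
    move=> x; rewrite /= in_itv/= => xL; rewrite normrM.
    by apply: ler_pM => //; [exact: FN|exact: psi'A].
  rewrite int_cst ?(ltW L0)// subr0.
  by have -> : N * A * L = A * L * N by ring.
have b2 : `|intc 0 L (fun x => h x * psi x)| <= A * N.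
  have i1 := integrable_mul_continuous hi cpsi.
  apply: le_trans (le_normr_Rintegral _ i1) _ => //.
  apply: (@le_trans _ _ (intc 0 L (fun x => A * `|h x|))).
    apply: le_Rintegral => //; first exact: (integrable_abse i1).
      exact: (@integrableZl _ _ _ mu _ _ A _ hai).
    move=> x; rewrite /= in_itv/= => xL; rewrite normrM mulrC ler_wpM2r//.
    exact: psiA.
  by rewrite RintegralZl.
have b3 : `|intc 0 L h * psi L| <= A * N.
  rewrite normrM mulrC; apply: ler_pM => //; first by apply: psiA; rewrite lexx (ltW L0).
  by apply: FN; rewrite lexx (ltW L0).
apply: le_trans (ler_normB _ _) _; apply: le_trans (lerD (ler_normD _ _) (lexx _)) _.
have -> : A * (L + 2) * N = A * L * N + A * N + A * N by ring.
by rewrite !lerD.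
Qed.

Lemma ac_integration_by_parts h : mu.-integrable `[0, L] (EFin \o h) ->
  intc 0 L (fun x => intc 0 x h * psi' x) =
  intc 0 L h * psi L - intc 0 L (fun x => h x * psi x).
Proof.
move=> hi; apply/eqP; rewrite -subr_eq0 opprB addrA; apply/eqP.
rewrite -/(E h).
pose D : set R := `[0, L].
have mL : (mu D < +oo)%E by rewrite /D lebesgue_measure_itv/=; case: ifP; rewrite // ltry.
have [g_ [cg gi]] := @approximation_continuous_integrable R D h (measurable_itv _) mL hi.
move=> /fine_cvgP[_ cv].
have {}cv : A * (L + 2) * intc 0 L (fun x => `|h x - g_ n x|) @[n --> \oo] --> (0 : R).
  rewrite -[X in _ --> X](mulr0 (A * (L + 2))); apply: cvgM; [exact: cvg_cst|exact: cv].
apply/normr0_eq0/le_anti; rewrite normr_ge0 andbT.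
have cvE : (fun=> `|E h|) @ \oo --> `|E h| by exact: cvg_cst.
apply: (ler_cvg_to cvE cv); apply: nearW => n.
have iB : mu.-integrable `[0, L] (EFin \o (h \- g_ n)) by apply: (integrableB _ hi (gi n)).
have B := E_bound iB.
have Eh : E (h \- g_ n) = E h.
  by rewrite E_sub; [rewrite (E_continuous (cg n)); exact: subr0|exact: hi|exact: gi].
by rewrite Eh in B.
Qed.

End AbsolutelyContinuousParts.
End IntegrationByParts.

(** * The continuous representative of a Sobolev function *)

Section SobolevEmbedding.
Local Open Scope classical_set_scope.
Context {R : realType}.
Implicit Types (f g h : R -> R) (a b x y L : R).
Notation mu := (@lebesgue_measure R).
Local Notation "'intc' a b f" := (\int[mu]_(x in `[a, b]) f x)
  (at level 10, a, b, f at level 9).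

(** The L-periodic function that agrees with f on [0, L). *)
Definition periodize L f x := f (x - L * (Num.floor (x / L))%:~R).

Lemma periodize_itv L f x : 0 < L -> f L = f 0 -> 0 <= x <= L -> periodize L f x = f x.
Proof.
move=> L0 fL /andP[x0]; rewrite le_eqVlt => /predU1P[->|xL].
  rewrite /periodize divff ?gt_eqF// (@floor_def _ _ 1);
    last by rewrite lexx/= intrD ltrDl ltr01.
  by rewrite mulr1 subrr.
rewrite /periodize (@floor_def _ _ 0) ?mulr0 ?subr0//.
by rewrite add0r divr_ge0 ?(ltW L0)//= ltr_pdivrMr// mul1r.
Qed.

Lemma periodize_periodic L f : 0 < L -> periodic (periodize L f) L.
Proof.
move=> L0 x; rewrite /periodize mulrDl divff ?gt_eqF// floorDrz// floor1.
by rewrite intrD mulrDr mulr1 opprD addrACA subrr addr0.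
Qed.

(** When f is extended by constants outside [0, L], its periodization is locally
    f (x - L N) + f (x - L (N - 1)) - f L: on either side of the lattice point
    L N one of the two translates is constant. *)
Lemma periodize_continuous L f : 0 < L -> continuous f -> f L = f 0 ->
  (forall x, x <= 0 -> f x = f 0) -> (forall x, L <= x -> f x = f L) ->
  continuous (periodize L f).
Proof.
move=> L0 cf fL f0 f1 p.
pose n := Num.floor (p / L).
have /andP[np pn] := floor_itv (p / L).
rewrite ler_pdivlMr// ltr_pdivrMr// in np pn; rewrite intrD in pn.
set N := (Num.floor (p / L))%:~R in np pn.
pose g x := f (x - L * N) + f (x - L * (N - 1)) - f L.
have cg : continuous g.
  have ct c : continuous (fun x : R => f (x - c)).
    by apply: (@continuous_compose _ f (fun x => x - c)) => //; apply: continuous_sub;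
      [by move=> z; exact: cvg_id|exact: continuous_const].
  by apply: continuous_sub; [apply: continuous_add; exact: ct|exact: continuous_const].
suff gE : \forall x \near p, g x = periodize L f x.
  rewrite /prop_for /continuous_at -(nbhs_singleton gE).
  apply: cvg_trans (cg p); exact: near_eq_cvg.
have : \forall x \near p, x \in `]((N - 1) * L), ((N + 1) * L)[%R.
  by apply: near_in_itvoo; rewrite in_itv/=; apply/andP; split; lra.
apply: filterS => x; rewrite in_itv/= => /andP[x1 x2].
rewrite /g /periodize.
have [xN|xN] := leP (N * L) x.
  rewrite (@floor_def _ _ (Num.floor (p / L))); last first.
    by rewrite ler_pdivlMr// ltr_pdivrMr// intrD xN.
  rewrite -/N (f1 (x - L * (N - 1))) ?addrK//; lra.
rewrite (@floor_def _ _ (Num.floor (p / L) - 1)); last first.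
  by rewrite ler_pdivlMr// ltr_pdivrMr// subrK intrB -/N (ltW x1).
rewrite intrB -/N (f0 (x - L * N)); last lra.
by rewrite fL addrAC subrr add0r.
Qed.

Lemma integration_by_parts_primitive L psi psi' h : 0 < L ->
  (forall x, is_derive x 1 psi (psi' x)) -> continuous psi' ->
  mu.-integrable `[0, L] (EFin \o h) ->
  intc 0 L (fun x => intc 0 x h * psi' x) =
  intc 0 L h * psi L - intc 0 L (fun x => h x * psi x).
Proof.
move=> L0 dpsi cpsi' hi.
have [A1 b1] := continuous_bounded 0 L (is_derive_continuous dpsi).
have [A2 b2] := continuous_bounded 0 L cpsi'.
apply: (@ac_integration_by_parts _ L psi psi' (Num.max A1 A2)) => // x xL.
  by rewrite le_max b1.
by rewrite le_max b2 ?orbT.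
Qed.

Lemma primitive_periodic L f : continuous f -> periodic f L -> primitive f L = 0 ->
  periodic (primitive f) L.
Proof.
move=> cf pf fL x; have df := is_derive_primitive cf.
apply: (@eq_fun_of_derive _ (fun x => primitive f (x + L)) _ f);
  first by rewrite add0r primitive0.
move=> y; have d1 : is_derive (1 * y + L) 1 (primitive f) (f y).
  have -> : f y = f (1 * y + L) by rewrite mul1r pf.
  exact: df.
have := is_derive_affine d1; rewrite mul1r.
by under eq_fun do rewrite mul1r.
Qed.

(** Let F be the primitive of the weak derivative g, which is continuous. The
    integration by parts formula for F shows that f - F annihilates all
    derivatives of periodic functions, that is, all periodic functions of mean
    zero. After the subtraction of its own mean c it annihilates every test
    function, and the fundamental lemma gives f = F + c almost everywhere. Since
    g has mean zero, F takes the same value at 0 and at L, and F + c has a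
    continuous periodic extension. *)
Lemma sobolev_representative L f g : 0 < L -> L2per L f -> L2per L g ->
  weak_derivative L f g -> exists ft, [/\ continuous ft, periodic ft L,
    {ae mu, forall x, 0 <= x <= L -> f x = ft x} &
    forall x y, 0 <= x -> x <= y -> y <= L -> ft y - ft x = intc x y g].
Proof.
move=> L0 Lf Lg w.
have fi := L2per_integrable Lf; have gi := L2per_integrable Lg.
have gL : intc 0 L g = 0.
  have d1 : derive1 (fun _ : R => 1 : R) = fun=> 0.
    by apply: derive1_fun => x; exact: is_derive_const.
  have C1 : C1per L (fun=> 1 : R).
    split; [by []|by move=> x; have [] := @is_derive_const R 1 x|].
    by rewrite d1; exact: continuous_const.
  have := w _ C1; rewrite d1.
  under eq_Rintegral do rewrite mulr0.
  under [in RHS]eq_Rintegral do rewrite mulr1.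
  by rewrite int_cst ?(ltW L0)// mul0r => /eqP; rewrite eq_sym oppr_eq0 => /eqP.
pose F x := intc 0 x g.
(* Composing with the projection onto [0, L] extends F by constants. *)
pose clamp x : R := Num.max 0 (Num.min x L).
have clampI x : 0 <= clamp x <= L.
  by rewrite /clamp le_max lexx/= ge_max (ltW L0) ge_min lexx orbT.
have clamp_id x : 0 <= x <= L -> clamp x = x.
  by move=> /andP[x0 xL]; rewrite /clamp (min_idPl xL) (max_idPr x0).
pose c := L^-1 * intc 0 L (fun x => f x - F x).
pose fc x := c + F (clamp x).
have Fdiff x y : 0 <= x -> x <= y -> y <= L -> F y - F x = intc x y g.
  move=> x0 xy yL; rewrite /F (int_split (integrable_subitv gi (lexx 0) yL) x0 xy).
  by rewrite addrAC subrr add0r.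
have clamp_mono x y : x <= y -> 0 <= clamp y - clamp x <= y - x.
  move=> xy; rewrite /clamp.
  have [?|?] := leP x L; have [?|?] := leP y L; have [?|?] := leP 0 x;
    have [?|?] := leP 0 y; rewrite ?(max_idPr (ltW L0)); apply/andP; split; lra.
have cfc : continuous fc.
  pose M := intc 0 L (fun t => g t ^+ 2).
  have M0 : 0 <= M by apply: Rintegral_ge0 => t _; exact: sqr_ge0.
  have H e x y : 0 < e -> x <= y -> y - x <= e ^+ 2 / (M + 1) -> `|fc x - fc y| <= e.
    move=> e0 xy yx; rewrite distrC /fc opprD addrACA subrr add0r.
    have /andP[c1 c2] := clamp_mono _ _ xy.
    have /andP[cx0 cxL] := clampI x; have /andP[cy0 cyL] := clampI y.
    rewrite Fdiff//; last by rewrite -subr_ge0.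
    apply: (@equicontinuity _ L g M) => //; first by rewrite -subr_ge0.
    exact: le_trans yx.
  move=> x; apply/(@cvgrPdist_le _ R^o) => e e0; near=> y.
  have : `|x - y| < e ^+ 2 / (M + 1).
    near: y; apply: (@cvgr_dist_lt _ _ _ (nbhs x) _ id x); first exact: cvg_id.
    by rewrite divr_gt0 ?exprn_gt0//; lra.
  rewrite ltr_norml => /andP[d1 d2].
  have [xy|/ltW yx] := leP x y; first by apply: H => //; lra.
  by rewrite distrC; apply: H => //; lra.
have fcL : fc L = fc 0.
  rewrite /fc !clamp_id ?lexx ?(ltW L0)// /F gL set_itv1 Rintegral_set1//.
exists (periodize L fc); split.
- apply: periodize_continuous => // x x0; congr (c + F _); rewrite /clamp ?minxx.
    by rewrite (min_idPl (le_trans x0 (ltW L0))) (max_idPl x0) (min_idPl (ltW L0)) maxxx.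
  by rewrite (min_idPr x0).
- exact: periodize_periodic.
- have : {ae mu, forall x, 0 <= x <= L -> (fun x => f x - F x - c) x = 0}.
    have Fi : mu.-integrable `[0, L] (EFin \o F) by exact: primitive_integrable.
    have ui : mu.-integrable `[0, L] (EFin \o (fun x => f x - F x)).
      exact: (integrableB _ fi Fi).
    apply: (fundamental_lemma L0).
      exact: (integrableB _ ui (integrable_cst 0 L c)).
    move=> phi [pphi dphi _].
    have cphi : continuous phi.
      by move=> x; apply: differentiable_continuous; apply/derivable1_diffP; exact: dphi.
    (* The primitive of phi minus its mean m is again a periodic test function. *)
    pose m := L^-1 * intc 0 L phi.
    pose psi' x := phi x - m.
    have cpsi' : continuous psi' by apply: continuous_sub => //; exact: continuous_const.
    have dpsi := is_derive_primitive cpsi'.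
    have phii := continuous_integrable 0 L cphi.
    have psiL : primitive psi' L = 0.
      rewrite primitiveE ?(ltW L0)// RintegralB//; last exact: integrable_cst.
      by rewrite int_cst ?(ltW L0)// subr0 /m; field; rewrite gt_eqF.
    have C1 : C1per L (primitive psi').
      split.
      - by apply: primitive_periodic => // x; rewrite /psi' pphi.
      - by move=> x; have [] := dpsi x.
      - by rewrite (derive1_fun dpsi).
    have E1 := w _ C1; rewrite (derive1_fun dpsi) in E1.
    have E2 := integration_by_parts_primitive L0 dpsi cpsi' gi.
    rewrite gL mul0r sub0r -E1 in E2.
    have fpi := integrable_mul_continuous fi cphi.
    have Fpi := integrable_mul_continuous Fi cphi.
    have upi := integrable_mul_continuous ui cphi.
    have uci : mu.-integrable `[0, L] (EFin \o (fun x => m * (f x - F x))).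
      exact: (@integrableZl _ _ _ mu _ _ m _ ui).
    have E3 : intc 0 L (fun x => (f x - F x) * psi' x) = 0.
      have -> : intc 0 L (fun x => (f x - F x) * psi' x) =
          intc 0 L (fun x => f x * psi' x - F x * psi' x).
        by apply: eq_Rintegral => x _; rewrite mulrBl.
      rewrite RintegralB//; [|exact: integrable_mul_continuous|
        exact: integrable_mul_continuous].
      by rewrite E2 subrr.
    have E4 : intc 0 L (fun x => (f x - F x) * psi' x) =
        intc 0 L (fun x => (f x - F x) * phi x) - m * intc 0 L (fun x => f x - F x).
      rewrite -RintegralZl// -RintegralB//; apply: eq_Rintegral => x _.
      by rewrite /psi'; ring.
    have cphii : mu.-integrable `[0, L] (EFin \o (fun x => c * phi x)).
      exact: (@integrableZl _ _ _ mu _ _ c _ phii).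
    have -> : intc 0 L (fun x => (f x - F x - c) * phi x) =
        intc 0 L (fun x => (f x - F x) * phi x) - c * intc 0 L phi.
      rewrite -RintegralZl// -RintegralB//; apply: eq_Rintegral => x _.
      by ring.
    have -> : intc 0 L (fun x => (f x - F x) * phi x) = m * intc 0 L (fun x => f x - F x).
      by apply/eqP; rewrite -subr_eq0 -E4 E3.
    by rewrite /c /m mulrAC subrr.
  apply: ae_imp => x h xL; rewrite periodize_itv// /fc clamp_id// addrC.
  by have := h xL; lra.
- move=> x y x0 xy yL; rewrite !periodize_itv//; [|lra|lra].
  rewrite /fc !clamp_id; [|lra|lra].
  rewrite -Fdiff//; lra.
Unshelve. all: by end_near. Qed.

End SobolevEmbedding.

(** * Oddness of the continuous representative *)

Section Odd.
Local Open Scope classical_set_scope.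
Context {R : realType}.
Implicit Types (f g h : R -> R) (a b x y L : R).
Notation mu := (@lebesgue_measure R).
Local Notation "'intc' a b f" := (\int[mu]_(x in `[a, b]) f x)
  (at level 10, a, b, f at level 9).

(** The primitive of q is nondecreasing, and it is periodic because the integral
    over a period vanishes; hence it is constant. *)
Lemma periodic_ge0_int0 L (q : R -> R) : 0 < L -> continuous q -> periodic q L ->
  (forall x, 0 <= q x) -> intc 0 L q = 0 -> forall x, q x = 0.
Proof.
move=> L0 cq pq q0 iq x.
have dH := is_derive_primitive cq.
have pH : periodic (primitive q) L by apply: primitive_periodic => //;
  rewrite primitiveE ?(ltW L0).
have mono y z : y <= z -> primitive q y <= primitive q z.
  by move=> yz; rewrite -subr_ge0 -(int_derivative dH cq yz); apply: Rintegral_ge0.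
have HL : primitive q (x - L) = primitive q x by rewrite -[in RHS](subrK L x) pH.
have near0 : \forall y \near x, cst (primitive q x) y = primitive q y.
  have : \forall y \near x, y \in `](x - L), (x + L)[%R.
    by apply: near_in_itvoo; rewrite in_itv/=; apply/andP; split; lra.
  apply: filterS => y; rewrite in_itv/= => /andP[y1 y2] /=.
  apply/le_anti; rewrite -{1}HL mono ?(ltW y1)//=.
  by rewrite -(pH x) mono// ltW.
have [_ E1] := near_eq_is_derive near0 (is_derive_cst (primitive q x) x (1 : R)).
by have [_ <-] := dH x.
Qed.

Lemma int_ae_eq a b f g : measurable_fun (`[a, b] : set R) f ->
  measurable_fun (`[a, b] : set R) g ->
  {ae mu, forall x, a <= x <= b -> f x = g x} -> intc a b f = intc a b g.
Proof.
move=> mf mg fg; congr fine; apply: ae_eq_integral => //.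
- exact/measurable_EFinP.
- exact/measurable_EFinP.
- by apply: ae_imp fg => x fg; rewrite /= in_itv/= => /fg ->.
Qed.

(** Lebesgue measure is invariant under the reflection x |-> c - x. *)
Lemma ae_reflect (c : R) (P : R -> Prop) : {ae mu, forall x, P x} ->
  {ae mu, forall x, P (c - x)}.
Proof.
have cm : measurable_fun [set: R] (fun x : R => c - x).
  apply: continuous_measurable_fun; apply: continuous_sub; first exact: continuous_const.
  by move=> x; exact: cvg_id.
move=> [A [mA A0 PA]].
exists ((fun x : R => c - x) @^-1` A); split.
- by rewrite -[X in measurable X]setTI; exact: cm.
- rewrite -[RHS]A0; apply/esym.
  transitivity (pushforward mu (fun x : R => (c - x : measurableTypeR R)) A); last by [].
  apply: lebesgue_measure_unique => // _ [[a b]] _ <-.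
  have E : (fun x : R => c - x) @^-1` `]a, b] = (`[c - b, c - a[ : set R).
    apply/seteqP; split => x; rewrite /= !in_itv/= => /andP[h1 h2];
      apply/andP; split; lra.
  transitivity (mu ((fun x : R => c - x) @^-1` `]a, b])); last by [].
  rewrite E !lebesgue_measure_itv/= !lte_fin -!EFinB.
  have -> : (c - b < c - a) = (a < b) by rewrite ltrD2l ltrN2.
  by have -> : c - a - (c - b) = b - a by ring.
- by move=> x /= Px; apply: PA.
Qed.

(** Periodicity turns f (- x) into f (L - x), so that the hypothesis compares
    values of f at two points of [0, L] only, where f can be replaced by ft. *)
Lemma odd_representative L f ft : 0 < L -> continuous ft -> periodic ft L -> periodic f L ->
  {ae mu, forall x, 0 <= x <= L -> f x = ft x} ->
  {ae mu, forall x, f (- x) = - f x} -> forall x, ft (- x) = - ft x.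
Proof.
move=> L0 cft pft pf fE fodd x.
have pN : periodic (fun x => ft (- x)) L.
  by move=> y /=; rewrite opprD -(pft (- y - L)) subrK.
have ch : continuous (fun x => ft (- x) + ft x).
  apply: continuous_add => //; apply: (@continuous_compose _ ft (fun x => - x)) => //.
  by move=> y; exact: continuousN (@cvg_id _ _).
pose q x := (ft (- x) + ft x) ^+ 2.
have cq : continuous q by exact: continuous_pow.
suff /eqP : q x = 0 by rewrite sqrf_eq0 addr_eq0 => /eqP.
apply: (periodic_ge0_int0 L0) => //.
- by move=> y; rewrite /q (pN y) pft.
- by move=> y; exact: sqr_ge0.
rewrite (@int_ae_eq _ _ _ (fun=> 0)); first by rewrite int_cst ?mul0r// ltW.
- by apply: measurable_funTS; exact: continuous_measurable_fun.
- by [].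
apply: (ae_imp3 _ fE (ae_reflect L fE) fodd) => y h1 h2 h3 yL.
rewrite /q -h1//; have := pft (- y); rewrite addrC => <-.
rewrite -h2; last by (apply/andP; split; move/andP: yL => [y0 yL]; lra).
by have := pf (- y); rewrite addrC => ->; rewrite h3 addNr expr0n.
Qed.
End Odd.

(** * The odd periodic solution operator of - v'' + s^2 v = f *)

Section Green.
Local Open Scope classical_set_scope.
Context {R : realType}.
Implicit Types (f g h : R -> R) (a b x y L : R).
Notation mu := (@lebesgue_measure R).
Local Notation "'intc' a b f" := (\int[mu]_(x in `[a, b]) f x)
  (at level 10, a, b, f at level 9).
Variables (s L : R).
Hypotheses (s0 : 0 < s) (L0 : 0 < L).

(** The two weights of the method of variation of constants for
    - v'' + s^2 v = f. *)
Definition wpos f x := primitive (fun t => expR (- s * t) * f t) x.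
Definition wneg f x := primitive (fun t => expR (s * t) * f t) x.

(** [green0] is the solution with zero Cauchy data at 0. The multiple of
    sinh (s x) subtracted in [green] makes it vanish at L, and [dgreen] is the
    derivative of [green]. *)
Definition green0 f x : R :=
  (2 * s)^-1 * (expR (- s * x) * wneg f x - expR (s * x) * wpos f x).
Definition green f x : R := green0 f x -
  green0 f L / (expR (s * L) - expR (- s * L)) * (expR (s * x) - expR (- s * x)).
Definition dgreen f x : R := - 2^-1 * (expR (- s * x) * wneg f x +
  expR (s * x) * wpos f x) -
  green0 f L / (expR (s * L) - expR (- s * L)) * (s * (expR (s * x) + expR (- s * x))).

Lemma is_derive_expR_lin (c : R) x :
  is_derive x 1 (fun t : R => expR (c * t)) (c * expR (c * x)).
Proof.
have dl : is_derive x 1 (fun t : R => c * t) (c * 1) by apply: is_derive_scale;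
  exact: is_derive_id.
by have := @is_derive_compose _ expR _ _ _ _ (is_derive_expR _) dl; rewrite mulr1 mulrC.
Qed.

Lemma continuous_expR_lin (c : R) : continuous (fun t : R => expR (c * t)).
Proof. exact: (is_derive_continuous (is_derive_expR_lin c)). Qed.

Lemma expR_lin_inv x : expR (s * x) * expR (- s * x) = 1.
Proof. by rewrite -expRD mulNr subrr expR0. Qed.

Lemma shL_gt0 : 0 < expR (s * L) - expR (- s * L).
Proof. by rewrite subr_gt0 ltr_expR; have := mulr_gt0 s0 L0; lra. Qed.

Lemma is_derive_wpos f x : continuous f -> is_derive x 1 (wpos f) (expR (- s * x) * f x).
Proof. move=> cf; apply: (is_derive_primitive (continuous_mul _ cf));
  exact: continuous_expR_lin. Qed.

Lemma is_derive_wneg f x : continuous f -> is_derive x 1 (wneg f) (expR (s * x) * f x).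
Proof. move=> cf; apply: (is_derive_primitive (continuous_mul _ cf));
  exact: continuous_expR_lin. Qed.

Lemma is_derive_green f x : continuous f -> is_derive x 1 (green f) (dgreen f x).
Proof.
move=> cf; have dp := is_derive_wpos x cf; have dn := is_derive_wneg x cf.
have dep := is_derive_expR_lin s x; have den := is_derive_expR_lin (- s) x.
have D := is_derive_sub (is_derive_scale (2 * s)^-1 (is_derive_sub
  (is_derive_mul den dn) (is_derive_mul dep dp)))
    (is_derive_scale (green0 f L / (expR (s * L) - expR (- s * L)))
      (is_derive_sub dep den)).
refine (is_derive_eq D _).
by rewrite /dgreen; field; rewrite gt_eqF ?shL_gt0// gt_eqF.
Qed.

Lemma is_derive_dgreen f x : continuous f ->
  is_derive x 1 (dgreen f) (s ^+ 2 * green f x - f x).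
Proof.
move=> cf; have dp := is_derive_wpos x cf; have dn := is_derive_wneg x cf.
have dep := is_derive_expR_lin s x; have den := is_derive_expR_lin (- s) x.
have D := is_derive_sub (is_derive_scale (- 2^-1) (is_derive_add
  (is_derive_mul den dn) (is_derive_mul dep dp)))
    (is_derive_scale (green0 f L / (expR (s * L) - expR (- s * L)))
      (is_derive_scale s (is_derive_add dep den))).
refine (is_derive_eq D _).
have fE : f x = expR (s * x) * expR (- s * x) * f x by rewrite expR_lin_inv mul1r.
rewrite [in RHS]fE /green {D fE}.
move: (_ / _) => K; rewrite /green0.
by field; rewrite gt_eqF.
Qed.

Lemma continuous_green f : continuous f -> continuous (green f).
Proof. by move=> cf; exact: (is_derive_continuous (fun x => is_derive_green x cf)). Qed.

Lemma continuous_dgreen f : continuous f -> continuous (dgreen f).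
Proof. by move=> cf; exact: (is_derive_continuous (fun x => is_derive_dgreen x cf)). Qed.

(** The change of variable t |-> - t exchanges the two weights when f is odd. *)
Lemma wpos_odd f x : continuous f -> (forall t, f (- t) = - f t) -> wpos f (- x) = wneg f x.
Proof.
move=> cf of_; move: x; apply: (@eq_fun_of_derive _ _ _ (fun x => expR (s * x) * f x)).
- by rewrite oppr0 /wpos /wneg !primitive0.
- move=> x; have d1 : is_derive (- 1 * x + 0) 1 (wpos f) (- (expR (s * x) * f x)).
    have -> : - (expR (s * x) * f x) = expR (- s * (- 1 * x + 0)) * f (- 1 * x + 0).
      by rewrite addr0 mulN1r mulrNN of_ mulrN.
    exact: is_derive_wpos.
  have := is_derive_affine d1; rewrite mulN1r opprK.
  by under eq_fun do rewrite addr0 mulN1r.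
- by move=> x; exact: is_derive_wneg.
Qed.

Lemma green_odd f x : continuous f -> (forall t, f (- t) = - f t) ->
  green f (- x) = - green f x.
Proof.
move=> cf of_; rewrite /green /green0 wpos_odd//.
have -> : wneg f (- x) = wpos f x by rewrite -wpos_odd// opprK.
rewrite mulrNN (_ : s * - x = - s * x) ?mulrN ?mulNr//.
move: (_ / _) (wneg f x) (wpos f x) (expR _) (expR _) => *; ring.
Qed.

Lemma greenL f : green f L = 0.
Proof. by rewrite /green divfK ?subrr// gt_eqF// shL_gt0. Qed.

(** Let v be the solution and w x = v (x + L) - v x. By periodicity of f,
    w'' = s^2 w, and w vanishes at 0 and at - L because v is odd and vanishes at
    0 and L. The combinations w' + s w and w' - s w are multiples of exp (s x) and
    exp (- s x), and these two zeros force both multiples to vanish. *)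
Lemma green_periodic f : continuous f -> (forall t, f (- t) = - f t) -> periodic f L ->
  periodic (green f) L.
Proof.
move=> cf of_ pf.
(* The factor 1 gives the shift the affine form of [is_derive_affine]. *)
pose w x := green f (1 * x + L) - green f x.
pose w' x := 1 * dgreen f (1 * x + L) - dgreen f x.
have dw x : is_derive x 1 w (w' x).
  exact: (is_derive_sub (is_derive_affine (is_derive_green (1 * x +
    L) cf)) (is_derive_green x cf)).
have dw' x : is_derive x 1 w' (s ^+ 2 * w x).
  have D := is_derive_sub (is_derive_scale 1 (is_derive_affine (is_derive_dgreen (1 * x +
    L) cf))) (is_derive_dgreen x cf).
  refine (is_derive_eq D _).
  by rewrite /w !mul1r pf; ring.
have gr0 : green f 0 = 0.
  have := green_odd 0 cf of_; rewrite oppr0 => /eqP; rewrite -addr_eq0 => /eqP; lra.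
have w0 : w 0 = 0 by rewrite /w mulr0 add0r greenL gr0 subrr.
have wL : w (- L) = 0 by rewrite /w mul1r addNr gr0 (green_odd _ cf of_) greenL oppr0 subrr.
have E1 x : expR (- s * x) * (w' x + s * w x) = w' 0.
  have -> : w' 0 = expR (- s * 0) * (w' 0 + s * w 0) by rewrite w0 !mulr0 addr0 expR0 mul1r.
  apply: (@is_derive_0_is_cst _ (fun x => expR (- s * x) * (w' x + s * w x))) => y.
  refine (is_derive_eq (is_derive_mul (is_derive_expR_lin (- s) y)
    (is_derive_add (dw' y) (is_derive_scale s (dw y)))) _).
  by ring.
have E2 x : expR (s * x) * (w' x - s * w x) = w' 0.
  have -> : w' 0 = expR (s * 0) * (w' 0 - s * w 0) by rewrite w0 !mulr0 subr0 expR0 mul1r.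
  apply: (@is_derive_0_is_cst _ (fun x => expR (s * x) * (w' x - s * w x))) => y.
  refine (is_derive_eq (is_derive_mul (is_derive_expR_lin s y)
    (is_derive_sub (dw' y) (is_derive_scale s (dw y)))) _).
  by ring.
have w'0 : w' 0 = 0.
  have F1 := E1 (- L); have F2 := E2 (- L).
  rewrite wL !mulr0 addr0 mulrNN in F1; rewrite wL !mulr0 subr0 mulrN -mulNr in F2.
  have : (expR (s * L) - expR (- s * L)) * w' (- L) = 0 by rewrite mulrBl F1 F2 subrr.
  by move/eqP; rewrite mulf_eq0 (gt_eqF shL_gt0)/= -F1 => /eqP ->; rewrite mulr0.
move=> x; apply/eqP; rewrite -subr_eq0; apply/eqP.
have -> : green f (x + L) - green f x = w x by rewrite /w mul1r.
have := E1 x; have := E2 x; rewrite w'0 => /eqP; rewrite mulf_eq0 gt_eqF ?expR_gt0//= =>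
  /eqP h1.
move/eqP; rewrite mulf_eq0 gt_eqF ?expR_gt0//= => /eqP h2.
have : 2 * s * w x = 0 by lra.
by move/eqP; rewrite !mulf_eq0 (gt_eqF s0) pnatr_eq0/= => /eqP.
Qed.

Lemma dgreen_periodic f : continuous f -> (forall t, f (- t) = - f t) -> periodic f L ->
  periodic (dgreen f) L.
Proof.
move=> cf of_ pf x.
have d1 : is_derive x 1 (fun x => green f (1 * x + L)) (1 * dgreen f (1 * x + L)).
  by apply: is_derive_affine; exact: is_derive_green.
have [_ <-] := is_derive_green x cf; rewrite -[dgreen f (x + L)]mul1r -[x in x + L]mul1r.
have [_ <-] := d1; congr ('D_1 _ x); apply/funext => y.
by rewrite mul1r green_periodic.
Qed.

Lemma int_bound f (A : R) x : continuous f -> (forall t, 0 <= t <= L -> `|f t| <= A) ->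
  0 <= x <= L -> `|intc 0 x f| <= A * L.
Proof.
move=> cf fA /andP[x0 xL].
have zL : 0 <= (0 : R) <= L by apply/andP; split => //; exact: ltW.
have A0 : 0 <= A by apply: le_trans (fA 0 zL).
have fi := continuous_integrable 0 x cf.
apply: le_trans (le_normr_Rintegral _ fi) _ => //.
apply: (@le_trans _ _ (intc 0 x (fun=> A))).
  apply: le_Rintegral => //; [exact: (integrable_abse fi)|exact: integrable_cst|].
  by move=> t; rewrite /= in_itv/= => /andP[t0 tx]; apply: fA; rewrite t0 (le_trans tx).
by rewrite int_cst// subr0 ler_wpM2l.
Qed.

Lemma green_bound : exists C : R, forall f (A : R), continuous f ->
  (forall t, 0 <= t <= L -> `|f t| <= A) -> forall x, 0 <= x <= L -> `|green f x| <= C * A.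
Proof.
have [B bB] := continuous_bounded 0 L (@continuous_expR_lin s).
have [B' bB'] := continuous_bounded 0 L (@continuous_expR_lin (- s)).
have zL : 0 <= (0 : R) <= L by apply/andP; split => //; exact: ltW.
have LL : 0 <= L <= L by apply/andP; split => //; exact: ltW.
have B0 : 0 <= B by exact: le_trans (bB _ zL).
have B'0 : 0 <= B' by exact: le_trans (bB' _ zL).
pose C0 := (2 * s)^-1 * (B' * (B * L) + B * (B' * L)).
pose S := (expR (s * L) - expR (- s * L))^-1.
have S0 : 0 <= S by rewrite invr_ge0 ltW// shL_gt0.
exists (C0 + C0 * S * (B + B')) => f A cf fA x xL.
have A0 : 0 <= A by exact: le_trans (fA _ zL).
have bN : forall x, 0 <= x <= L -> `|wneg f x| <= (B * A) * L.
  move=> y yL; rewrite /wneg primitiveE; last 2 first.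
  - by apply: continuous_mul => //; exact: continuous_expR_lin.
  - by case/andP: yL.
  apply: int_bound => //; first by apply: continuous_mul => //; exact: continuous_expR_lin.
  by move=> t tL; rewrite normrM; apply: ler_pM => //; [exact: bB|exact: fA].
have bP : forall x, 0 <= x <= L -> `|wpos f x| <= (B' * A) * L.
  move=> y yL; rewrite /wpos primitiveE; last 2 first.
  - by apply: continuous_mul => //; exact: continuous_expR_lin.
  - by case/andP: yL.
  apply: int_bound => //; first by apply: continuous_mul => //; exact: continuous_expR_lin.
  by move=> t tL; rewrite normrM; apply: ler_pM => //; [exact: bB'|exact: fA].
have b0 : forall x, 0 <= x <= L -> `|green0 f x| <= C0 * A.
  move=> y yL; rewrite /green0 normrM ger0_norm; last by rewrite invr_ge0 mulr_ge0// ltW.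
  rewrite /C0 -mulrA; apply: ler_wpM2l; first by rewrite invr_ge0 mulr_ge0// ltW.
  apply: le_trans (ler_normB _ _) _.
  have -> : (B' * (B * L) + B * (B' * L)) * A = B' * ((B * A) * L) +
    B * ((B' * A) * L) by ring.
  rewrite !normrM; apply: lerD; apply: ler_pM => //;
    [exact: bB'|exact: bN|exact: bB|exact: bP].
apply: le_trans (ler_normB _ _) _; rewrite mulrDl; apply: lerD; first exact: b0.
rewrite normrM (normrM (green0 f L)) -/S (ger0_norm S0).
have -> : C0 * S * (B + B') * A = C0 * A * S * (B + B') by ring.
apply: ler_pM => //; first by rewrite mulr_ge0.
  by apply: ler_wpM2r; [exact: S0|exact: b0].
by apply: le_trans (ler_normB _ _) _; apply: lerD; [exact: bB|exact: bB'].
Qed.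

(** The solution is an explicit combination of integrals of f, so that bounded
    pointwise convergence of the data is enough. *)
Lemma cvg_green (f_ : nat -> R -> R) f (A : R) : continuous f ->
  (forall n, continuous (f_ n)) ->
  (forall n t, 0 <= t <= L -> `|f_ n t| <= A) ->
  (forall t, 0 <= t <= L -> f_ n t @[n --> \oo] --> f t) ->
  forall x, 0 <= x <= L -> green (f_ n) x @[n --> \oo] --> green f x.
Proof.
move=> cf cfn fA ff.
have cw c x : 0 <= x <= L ->
    primitive (fun t => expR (c * t) * f_ n t) x @[n --> \oo] --> primitive
      (fun t => expR (c * t) * f t) x.
  move=> /andP[x0 xL].
  under eq_fun do (rewrite primitiveE//; last by apply: continuous_mul => //;
    exact: continuous_expR_lin).
  rewrite primitiveE//; last by apply: continuous_mul => //; exact: continuous_expR_lin.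
  apply: (@dominated_cvg_mul _ 0 x (fun t => expR (c * t)) f_ f A) => //.
  - by apply: continuous_integrable; exact: continuous_expR_lin.
  - by move=> n t /andP[t0 tx]; apply: fA; rewrite t0 (le_trans tx).
  - by move=> t /andP[t0 tx]; apply: ff; rewrite t0 (le_trans tx).
have c0 x : 0 <= x <= L -> green0 (f_ n) x @[n --> \oo] --> green0 f x.
  move=> xL; apply: cvgM; first exact: cvg_cst.
  by apply: cvgB; (apply: cvgM; [exact: cvg_cst|exact: cw]).
move=> x xL; apply: cvgB; first exact: c0.
apply: cvgM; last exact: cvg_cst; apply: cvgM; last exact: cvg_cst.
by apply: c0; rewrite lexx ltW.
Qed.

End Green.

(** * From complex Sobolev functions to pairs of real functions *)

Section Bridge.
Local Open Scope classical_set_scope.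
Context {R : realType}.
Implicit Types (f g h a b : R -> R) (x y L : R).
Notation mu := (@lebesgue_measure R).
Local Notation "'intc' a b f" := (\int[mu]_(x in `[a, b]) f x)
  (at level 10, a, b, f at level 9).
Variables (L : R) (L0 : 0 < L).

Lemma integrable_add x y f g : mu.-integrable `[x, y] (EFin \o f) ->
  mu.-integrable `[x, y] (EFin \o g) ->
  mu.-integrable `[x, y] (EFin \o (fun t => f t + g t)).
Proof. by move=> fi gi; apply: (integrableD _ fi gi). Qed.

Lemma integrable_diff x y f g : mu.-integrable `[x, y] (EFin \o f) ->
  mu.-integrable `[x, y] (EFin \o g) ->
  mu.-integrable `[x, y] (EFin \o (fun t => f t - g t)).
Proof. by move=> fi gi; apply: (integrableB _ fi gi). Qed.

Lemma integrable_scale x y f (c : R) : mu.-integrable `[x, y] (EFin \o f) ->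
  mu.-integrable `[x, y] (EFin \o (fun t => c * f t)).
Proof. by move=> fi; exact: (@integrableZl _ _ _ mu _ _ c _ fi). Qed.

Lemma continuous_C1per phi : C1per L phi -> continuous phi.
Proof.
move=> [_ dphi _] x; apply: differentiable_continuous; apply/derivable1_diffP; exact: dphi.
Qed.

Lemma continuous_L2per f : continuous f -> periodic f L -> L2per L f.
Proof.
move=> cf pf; split => //; first exact: continuous_measurable_fun.
by apply: continuous_integrable; exact: continuous_pow.
Qed.

Lemma L2perZ (c : R) f : L2per L f -> L2per L (fun x => c * f x).
Proof.
move=> [pf mf f2]; split.
- by move=> x; rewrite pf.
- exact: (measurable_funM _ mf).
- have : mu.-integrable `[0, L] (fun x => ((c ^+ 2)%:E * (f x ^+ 2)%:E)%E)
  by exact: integrableZl.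
  by congr is_true; congr integrable; apply/funext => x /=; rewrite -EFinM exprMn.
Qed.

Lemma weak_derivativeZ (c : R) f g : L2per L f -> L2per L g ->
  weak_derivative L f g -> weak_derivative L (fun x => c * f x) (fun x => c * g x).
Proof.
move=> Lf Lg w phi Cphi; have cphi := continuous_C1per Cphi.
have [_ _ cphi'] := Cphi.
have fi := integrable_mul_continuous (L2per_integrable Lf) cphi'.
have gi := integrable_mul_continuous (L2per_integrable Lg) cphi.
under eq_Rintegral do rewrite -mulrA; rewrite RintegralZl//.
under [in RHS]eq_Rintegral do rewrite -mulrA; rewrite RintegralZl//.
by rewrite w// mulrN.
Qed.

(** Integrate the derivative of psi phi over a period. *)
Lemma weak_derivative_C1 psi psi' : (forall x, is_derive x 1 psi (psi' x)) ->
  continuous psi' -> periodic psi L -> weak_derivative L psi psi'.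
Proof.
move=> dpsi cpsi' ppsi phi Cphi; have cphi := continuous_C1per Cphi.
have [pphi dphi cphi'] := Cphi.
have cpsi := is_derive_continuous dpsi.
have dphi' x : is_derive x 1 phi (derive1 phi x) by apply: DeriveDef => //;
  rewrite derive1E.
have := int_derivative (fun x => is_derive_mul (dpsi x) (dphi' x))
  (continuous_add (continuous_mul cpsi' cphi) (continuous_mul cpsi cphi')) (ltW L0).
rewrite RintegralD//; [|exact: continuous_integrable (continuous_mul cpsi' cphi)|
  exact: continuous_integrable (continuous_mul cpsi cphi')].
have -> : psi L = psi 0 by rewrite -[L in LHS]add0r ppsi.
have -> : phi L = phi 0 by rewrite -[L in LHS]add0r pphi.
by rewrite subrr addrC => /eqP; rewrite addr_eq0 => /eqP.
Qed.

Lemma weak_derivative_ae f ft g : L2per L f -> L2per L ft ->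
  {ae mu, forall x, 0 <= x <= L -> f x = ft x} ->
  weak_derivative L f g -> weak_derivative L ft g.
Proof.
move=> [_ mf _] [_ mft _] fE w phi Cphi; rewrite -w//.
have [_ _ cphi'] := Cphi.
have mp : measurable_fun [set: R] (derive1 phi) by exact: continuous_measurable_fun.
apply: int_ae_eq.
- by apply: measurable_funTS; exact: (measurable_funM mft mp).
- by apply: measurable_funTS; exact: (measurable_funM mf mp).
- by apply: (ae_imp _ fE) => x E /E ->.
Qed.

Lemma wderivP f : H1per L f -> L2per L (wderiv L f) /\ weak_derivative L f (wderiv L f).
Proof.
move=> [_ [g Lg wg]].
exact: (@xgetPex _ (fun=> 0) [set g | L2per L g /\ weak_derivative L f g] (ex_intro _ g
  (conj Lg wg))).
Qed.

Lemma wderiv_ae f g : H1per L f -> L2per L g -> weak_derivative L f g ->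
  {ae mu, forall x, 0 <= x <= L -> wderiv L f x = g x}.
Proof.
move=> /wderivP[Lw ww] Lg wg.
exact: (weak_derivative_unique L0 Lw Lg ww wg).
Qed.

Lemma cmod_sqr (z : R[i]) : cmod z ^+ 2 = complex.Re z ^+ 2 + complex.Im z ^+ 2.
Proof. by case: z => a b; rewrite /cmod /= sqr_sqrtr// addr_ge0 ?sqr_ge0. Qed.

Lemma cmod_even (z : R[i]) n : cmod z ^+ n.*2 = (complex.Re z ^+ 2 +
  complex.Im z ^+ 2) ^+ n.
Proof. by rewrite -mul2n exprM cmod_sqr. Qed.

Definition energy (omega : R) (a b a' b' : R -> R) : R :=
  intc 0 L (fun x => a' x ^+ 2 + b' x ^+ 2 + omega * (a x ^+ 2 + b x ^+ 2)).

Lemma energy_integrable (omega : R) a b a' b' : L2per L a -> L2per L b -> L2per L a' ->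
  L2per L b' ->
  mu.-integrable `[0, L] (EFin \o (fun x => a' x ^+ 2 + b' x ^+ 2 + omega * (a x ^+ 2 +
    b x ^+ 2))).
Proof.
by move=> [_ _ ai] [_ _ bi] [_ _ ai'] [_ _ bi']; apply: integrable_add;
  [|apply: integrable_scale]; exact: integrable_add.
Qed.

Lemma ae_eq_sym f g : {ae mu, forall x, 0 <= x <= L -> f x = g x} ->
  {ae mu, forall x, 0 <= x <= L -> g x = f x}.
Proof. by apply: ae_imp => x E xL; rewrite E. Qed.

Lemma measurable_sqr f : L2per L f -> measurable_fun [set: R] (fun x => f x ^+ 2).
Proof. by move=> [_ mf _]; exact: measurable_funX. Qed.

(** [Benergy] is defined through a chosen weak derivative of a function given up
    to null sets; by uniqueness any representative and any weak derivative give
    the same value. *)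
Lemma Benergy_energy omega (u : R -> R[i]) a b a' b' : HH1per L u ->
  {ae mu, forall x, 0 <= x <= L -> re_part u x = a x} ->
  {ae mu, forall x, 0 <= x <= L -> im_part u x = b x} ->
  L2per L a -> L2per L b -> L2per L a' -> L2per L b' ->
  weak_derivative L a a' -> weak_derivative L b b' ->
  2 * Benergy L omega u = energy omega a b a' b'.
Proof.
move=> [Ha Hb] ua ub La Lb La' Lb' wa wb.
have [LRe _] := Ha; have [LIm _] := Hb.
have wRe := weak_derivative_ae La LRe (ae_eq_sym ua) wa.
have wIm := weak_derivative_ae Lb LIm (ae_eq_sym ub) wb.
have ga := wderiv_ae Ha La' wRe; have gb := wderiv_ae Hb Lb' wIm.
have [Lwa _] := wderivP Ha; have [Lwb _] := wderivP Hb.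
rewrite /Benergy mulrA divff ?pnatr_eq0// mul1r /energy.
have -> : (fun x => cmod (wderivC L u x) ^+ 2 + omega * cmod (u x) ^+ 2) =
  (fun x => wderiv L (re_part u) x ^+ 2 + wderiv L (im_part u) x ^+ 2 +
     omega * (re_part u x ^+ 2 + im_part u x ^+ 2)).
  by apply/funext => x; rewrite !cmod_sqr.
have meas4 f g h k : L2per L f -> L2per L g -> L2per L h -> L2per L k ->
  measurable_fun (`[0, L] : set R) (fun x => h x ^+ 2 + k x ^+ 2 + omega * (f x ^+ 2 +
    g x ^+ 2)).
  move=> Lf Lg Lh Lk; apply: measurable_funTS.
  have m1 := measurable_funD (measurable_sqr Lh) (measurable_sqr Lk).
  have m2 := measurable_funD (measurable_sqr Lf) (measurable_sqr Lg).
  exact: (measurable_funD m1 (measurable_funM (measurable_cst omega) m2)).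
apply: int_ae_eq; [exact: meas4|exact: meas4|].
apply: (ae_imp2 _ (ae_imp2 (fun x P Q => conj P Q) ga gb) (ae_imp2
  (fun x P Q => conj P Q) ua ub)) => x [e1 e2] [e3 e4] xL.
by rewrite e1// e2// e3// e4.
Qed.

Definition odd_periodic f := [/\ continuous f, periodic f L & forall x, f (- x) = - f x].

(** What remains of an element of the constraint set, for the exponent
    2 m + 2, once it is replaced by its continuous representative a + i b:
    a' and b' are square-integrable weak derivatives, and the increments of a
    and b are their integrals. *)
Record admissible (m : nat) (upsilon : R) (a b a' b' : R -> R) : Prop := {
  adm_a : odd_periodic a;
  adm_b : odd_periodic b;
  adm_a' : L2per L a';
  adm_b' : L2per L b';
  adm_wa : weak_derivative L a a';
  adm_wb : weak_derivative L b b';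
  adm_incr_a : forall x y, 0 <= x -> x <= y -> y <= L -> a y - a x = intc x y a';
  adm_incr_b : forall x y, 0 <= x -> x <= y -> y <= L -> b y - b x = intc x y b';
  adm_norm : intc 0 L (fun x => (a x ^+ 2 + b x ^+ 2) ^+ m.+1) = upsilon }.

Lemma admissible_of_Xset m upsilon omega u : Xset L m.*2 upsilon u ->
  exists a b a' b', admissible m upsilon a b a' b' /\ 2 * Benergy L omega u =
    energy omega a b a' b'.
Proof.
move=> [[[Ha Hb] uodd] unorm].
have [Lwa wwa] := wderivP Ha; have [Lwb wwb] := wderivP Hb.
have [LRe _] := Ha; have [LIm _] := Hb.
have [a [ca pa ua ia]] := sobolev_representative L0 LRe Lwa wwa.
have [b [cb pb ub ib]] := sobolev_representative L0 LIm Lwb wwb.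
have La := continuous_L2per ca pa; have Lb := continuous_L2per cb pb.
have [pRe mRe _] := LRe; have [pIm mIm _] := LIm.
have oa x : a (- x) = - a x.
  apply: (odd_representative L0 ca pa pRe ua).
  by apply: (ae_imp _ uodd) => y; rewrite /re_part => ->; case: (u y).
have ob x : b (- x) = - b x.
  apply: (odd_representative L0 cb pb pIm ub).
  by apply: (ae_imp _ uodd) => y; rewrite /im_part => ->; case: (u y).
exists a, b, (wderiv L (re_part u)), (wderiv L (im_part u)).
have wa := weak_derivative_ae LRe La ua wwa.
have wb := weak_derivative_ae LIm Lb ub wwb.
split; last exact: Benergy_energy.
split; [by split|by split|exact: Lwa|exact: Lwb|exact: wa|exact: wb|exact: ia|exact: ib|].
rewrite -unorm.
have -> : (fun x => cmod (u x) ^+ (m.*2 + 2)) =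
    (fun x => (re_part u x ^+ 2 + im_part u x ^+ 2) ^+ m.+1).
  by apply/funext => x; rewrite -[2%N]/(1.*2) -doubleD addn1 cmod_even.
have meas f g : L2per L f -> L2per L g ->
  measurable_fun (`[0, L] : set R) (fun x => (f x ^+ 2 + g x ^+ 2) ^+ m.+1).
  move=> Lf Lg; apply: measurable_funTS; apply: measurable_funX.
  exact: (measurable_funD (measurable_sqr Lf) (measurable_sqr Lg)).
apply: int_ae_eq; [exact: meas|exact: meas|].
by apply: (ae_imp2 _ ua ub) => x e1 e2 xL; rewrite e1// e2.
Qed.

Lemma H1per_C1 a a' : (forall x, is_derive x 1 a (a' x)) -> continuous a' ->
  periodic a L -> periodic a' L -> H1per L a.
Proof.
move=> da ca' pa pa'; split; first exact: continuous_L2per (is_derive_continuous da) pa.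
exists a'; first exact: continuous_L2per.
exact: weak_derivative_C1.
Qed.

Lemma Xset_of_C1 m upsilon omega a b a' b' : odd_periodic a -> odd_periodic b ->
  (forall x, is_derive x 1 a (a' x)) -> (forall x, is_derive x 1 b (b' x)) ->
  continuous a' -> continuous b' -> periodic a' L -> periodic b' L ->
  intc 0 L (fun x => (a x ^+ 2 + b x ^+ 2) ^+ m.+1) = upsilon ->
  Xset L m.*2 upsilon (fun x => a x +i* b x) /\
  2 * Benergy L omega (fun x => a x +i* b x) = energy omega a b a' b'.
Proof.
move=> [ca pa oa] [cb pb ob] da db ca' cb' pa' pb' ab.
have HH : HH1per L (fun x => a x +i* b x).
  by split; [exact: (H1per_C1 da)|exact: (H1per_C1 db)].
split; last first.
  apply: Benergy_energy => //; try exact: continuous_L2per; try exact: weak_derivative_C1.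
    exact: aeW.
  exact: aeW.
split; first by split => //; apply: aeW => x; rewrite oa ob.
rewrite -ab; congr Rintegral; apply/funext => x.
by rewrite -[2%N in LHS]/(1.*2) -doubleD addn1 cmod_even.
Qed.

Lemma BenergyZ omega (c : R) (u : R -> R[i]) : HH1per L u ->
  HH1per L (fun x => c%:C * u x) /\ Benergy L omega (fun x => c%:C * u x) =
    c ^+ 2 * Benergy L omega u.
Proof.
move=> [Ha Hb].
have reE : re_part (fun x => c%:C * u x) = (fun x => c * re_part u x).
  by apply/funext => x; rewrite /re_part; case: (u x) => p q /=; rewrite mul0r subr0.
have imE : im_part (fun x => c%:C * u x) = (fun x => c * im_part u x).
  by apply/funext => x; rewrite /im_part; case: (u x) => p q /=; rewrite mul0r addr0.
have [Lwa wwa] := wderivP Ha; have [Lwb wwb] := wderivP Hb.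
have [LRe _] := Ha; have [LIm _] := Hb.
have La := L2perZ c LRe; have Lb := L2perZ c LIm.
have La' := L2perZ c Lwa; have Lb' := L2perZ c Lwb.
have wa := weak_derivativeZ c LRe Lwa wwa; have wb := weak_derivativeZ c LIm Lwb wwb.
have HH : HH1per L (fun x => c%:C * u x).
  by split; rewrite ?reE ?imE; split => //; [exists
    (fun x => c * wderiv L (re_part u) x)|exists (fun x => c * wderiv L (im_part u) x)].
split => //.
have E1 : 2 * Benergy L omega u = energy omega (re_part u) (im_part u) (wderiv L
  (re_part u)) (wderiv L (im_part u)).
  by apply: Benergy_energy => //; exact: aeW.
have e1 : {ae mu, forall x, 0 <= x <= L -> re_part (fun x => c%:C * u x) x =
  c * re_part u x}.
  by rewrite reE; exact: aeW.
have e2 : {ae mu, forall x, 0 <= x <= L -> im_part (fun x => c%:C * u x) x =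
  c * im_part u x}.
  by rewrite imE; exact: aeW.
have E2 := Benergy_energy omega HH e1 e2 La Lb La' Lb' wa wb.
suff E3 : 2 * Benergy L omega (fun x => c%:C * u x) = c ^+ 2 * (2 * Benergy L omega u)
  by lra.
rewrite E1 E2 /energy -RintegralZl//; last exact: energy_integrable.
by congr Rintegral; apply/funext => x; ring.
Qed.

End Bridge.

(** * The dual functional and its two inequalities *)

Section Variational.
Local Open Scope classical_set_scope.
Context {R : realType}.
Implicit Types (f g h a b : R -> R) (x y L : R).
Notation mu := (@lebesgue_measure R).
Local Notation "'intc' a b f" := (\int[mu]_(x in `[a, b]) f x)
  (at level 10, a, b, f at level 9).

(** The step of the induction is the rearrangement inequality
    (x - y) (x^(m+1) - y^(m+1)) >= 0. *)
Lemma young_nat (m : nat) (x y : R) : 0 <= x -> 0 <= y ->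
  m.+1%:R * (x ^+ m * y) <= m%:R * x ^+ m.+1 + y ^+ m.+1.
Proof.
move=> x0 y0; elim: m => [|m IH]; first by rewrite !expr0 expr1 !mul1r mul0r add0r.
have D : x ^+ m.+1 * y + x * y ^+ m.+1 <= x ^+ m.+2 + y ^+ m.+2.
  rewrite -subr_ge0 (_ : _ - _ = (x - y) * (x ^+ m.+1 - y ^+ m.+1)); last first.
    by rewrite (exprS x m.+1) (exprS y m.+1); ring.
  have [xy|yx] := leP x y.
    by apply: mulr_le0; rewrite subr_le0// lerXn2r ?nnegrE.
  by apply: mulr_ge0; rewrite subr_ge0 ?(ltW yx)// lerXn2r ?nnegrE ?(ltW yx).
have IHx := ler_wpM2l x0 IH.
rewrite -(natr1 m.+1) -[in X in _ <= X](natr1 m).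
have e1 : x * (m.+1%:R * (x ^+ m * y)) = m.+1%:R * (x ^+ m.+1 * y) by rewrite exprS; ring.
have e2 : x * (m%:R * x ^+ m.+1 + y ^+ m.+1) = m%:R * x ^+ m.+2 + x * y ^+ m.+1
  by rewrite (exprS x m.+1); ring.
rewrite e1 e2 in IHx; rewrite !mulrDl !mul1r; lra.
Qed.

(** Re (|u|^(2m) u conj(w)) <= ((2m+1) |u|^(2m+2) + |w|^(2m+2)) / (2m+2) for
    u = p + i q and w = r + i t. Evenness of the exponent keeps the moduli
    polynomial: bound 2 Re (u conj(w)) by |u|^2 + |w|^2, then apply [young_nat]
    to the squared moduli. *)
Lemma young_pair (m : nat) (p q r t : R) :
  m.+1.*2%:R * ((p ^+ 2 + q ^+ 2) ^+ m * (p * r + q * t)) <=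
  m.*2.+1%:R * (p ^+ 2 + q ^+ 2) ^+ m.+1 + (r ^+ 2 + t ^+ 2) ^+ m.+1.
Proof.
set N := p ^+ 2 + q ^+ 2; set M := r ^+ 2 + t ^+ 2.
have N0 : 0 <= N by rewrite addr_ge0 ?sqr_ge0.
have M0 : 0 <= M by rewrite addr_ge0 ?sqr_ge0.
have Y := young_nat m N0 M0.
have C : 2 * (p * r + q * t) <= N + M.
  rewrite -subr_ge0 (_ : _ - _ = (p - r) ^+ 2 + (q - t) ^+ 2) ?addr_ge0 ?sqr_ge0//.
  by rewrite /N /M; ring.
have Nm : 0 <= m.+1%:R * N ^+ m by rewrite mulr_ge0// exprn_ge0.
have := ler_wpM2l Nm C.
rewrite -!muln2 -[in X in _ -> _ <= X]addn1 !natrM natrD -(natr1 m) in Y *.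
rewrite !exprS in Y *.
by move: Y; set z : R := m%:R; set w := N ^+ m; set w' := M ^+ m => Y Z; lra.
Qed.

Lemma root_exists n (x : R) : 0 < x -> exists2 t : R, 0 < t & t ^+ n.+1 = x.
Proof.
move=> x0; exists (expR (ln x / n.+1%:R)); first exact: expR_gt0.
by rewrite -expRM_natl mulrC divfK ?pnatr_eq0// lnK.
Qed.

Section Data.
Variables (L s : R) (m : nat).
Hypotheses (L0 : 0 < L) (s0 : 0 < s).
Let omega := s ^+ 2.

(** The real part of |u|^(2m) u for u = a + i b; [force m b a] is its imaginary
    part. *)
Definition force m a b x : R := (a x ^+ 2 + b x ^+ 2) ^+ m * a x.
Local Notation frc := (force m).
Local Notation grn := (green s L).
Local Notation dgrn := (dgreen s L).
Local Notation odper := (odd_periodic L).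

(** The integral of |u|^(2m+2), the quantity prescribed by the constraint. *)
Definition pnorm m a b : R := intc 0 L (fun x => (a x ^+ 2 + b x ^+ 2) ^+ m.+1).

(** The pairing of f = |u|^(2m) u with the solution v of - v'' + s^2 v = f. It
    is the energy of v. *)
Definition dual_form a b : R :=
  intc 0 L (fun x => frc a b x * grn (frc a b) x + frc b a x * grn (frc b a) x).

Lemma continuous_sqrsum n a b : continuous a -> continuous b ->
  continuous (fun x => (a x ^+ 2 + b x ^+ 2) ^+ n).
Proof. by move=> ca cb; apply: continuous_pow; apply: continuous_add;
  exact: continuous_pow. Qed.

Lemma force_odd_periodic a b : odper a -> odper b -> odper (frc a b).
Proof.
move=> [ca pa oa] [cb pb ob]; split.
- by apply: continuous_mul => //; exact: continuous_sqrsum.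
- by move=> x; rewrite /force pa pb.
- by move=> x; rewrite /force oa ob !sqrrN mulrN.
Qed.

Lemma green_odd_periodic f : odper f -> odper (grn f).
Proof.
move=> [cf pf of_]; split; [exact: continuous_green|exact: green_periodic|].
by move=> x; exact: green_odd.
Qed.

Lemma dgreen_C1per f : odper f -> C1per L (dgrn f).
Proof.
move=> [cf pf of_].
have dd x := is_derive_dgreen L s0 x cf.
split; first exact: dgreen_periodic.
- by move=> x; have [] := dd x.
- rewrite (derive1_fun dd); apply: continuous_sub => //; apply: continuous_mul;
  first exact: continuous_const.
  exact: continuous_green.
Qed.

Lemma odd_periodic_L2per f : odper f -> L2per L f.
Proof. by move=> [cf pf _]; exact: continuous_L2per. Qed.

Lemma dgreen_L2per f : odper f -> L2per L (dgrn f).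
Proof.
move=> [cf pf of_]; apply: continuous_L2per; first exact: continuous_dgreen.
exact: dgreen_periodic.
Qed.

(** For v = grn f, the derivative v' is a legitimate test function, and
    f = s^2 v - v''. *)
Lemma weak_green f u g : odper f -> L2per L u -> L2per L g -> weak_derivative L u g ->
  intc 0 L (fun x => f x * u x) = intc 0 L (fun x => dgrn f x * g x +
    omega * (grn f x * u x)).
Proof.
move=> of_ Lu Lg w; have [cf _ _] := of_.
have dd x := is_derive_dgreen L s0 x cf.
have E := w _ (dgreen_C1per of_); rewrite (derive1_fun dd) in E.
have iu := L2per_integrable Lu; have ig := L2per_integrable Lg.
have Lv := odd_periodic_L2per (green_odd_periodic of_).
have i1 := L2per_integrable_mul (odd_periodic_L2per of_) Lu.
have i2 := L2per_integrable_mul (dgreen_L2per of_) Lg.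
have i3 := L2per_integrable_mul Lv Lu.
have i3' := integrable_scale omega i3.
rewrite RintegralD//.
have -> : intc 0 L (fun x => f x * u x) =
    intc 0 L (fun x => omega * (grn f x * u x) - u x * (s ^+ 2 * grn f x - f x)).
  by congr Rintegral; apply/funext => x; rewrite /omega; ring.
rewrite RintegralB//; last first.
  have := integrable_diff i3' i1; congr is_true; congr integrable; apply/funext => x /=.
  by congr EFin; rewrite /omega; ring.
rewrite E opprK addrC; congr (_ + _).
by congr Rintegral; apply/funext => x; rewrite mulrC.
Qed.

Lemma weak_green_green f : odper f -> weak_derivative L (grn f) (dgrn f).
Proof.
move=> of_; have [cf pf o] := of_.
apply: (weak_derivative_C1 L0 (fun x => is_derive_green s0 L0 x cf));
  first exact: continuous_dgreen.
exact: green_periodic.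
Qed.

Section Pair.
Variables (a b : R -> R).
Hypotheses (oa : odper a) (ob : odper b).
Local Notation v1 := (grn (frc a b)).
Local Notation v2 := (grn (frc b a)).
Local Notation d1 := (dgrn (frc a b)).
Local Notation d2 := (dgrn (frc b a)).

Lemma force_pairing x : frc a b x * a x + frc b a x * b x = (a x ^+ 2 + b x ^+ 2) ^+ m.+1.
Proof. by rewrite /force [b x ^+ 2 + _]addrC (exprS _ m); ring. Qed.

Lemma pairing_green (u1 u2 g1 g2 : R -> R) : L2per L u1 -> L2per L u2 -> L2per L g1 ->
  L2per L g2 ->
  weak_derivative L u1 g1 -> weak_derivative L u2 g2 ->
  intc 0 L (fun x => frc a b x * u1 x + frc b a x * u2 x) =
  intc 0 L (fun x => d1 x * g1 x + d2 x * g2 x + omega * (v1 x * u1 x + v2 x * u2 x)).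
Proof.
move=> Lu1 Lu2 Lg1 Lg2 w1 w2.
have o1 := force_odd_periodic oa ob; have o2 := force_odd_periodic ob oa.
have Lf1 := odd_periodic_L2per o1; have Lf2 := odd_periodic_L2per o2.
have Lv1 := odd_periodic_L2per (green_odd_periodic o1);
  have Lv2 := odd_periodic_L2per (green_odd_periodic o2).
have Ld1 := dgreen_L2per o1; have Ld2 := dgreen_L2per o2.
rewrite RintegralD//; [|exact: L2per_integrable_mul|exact: L2per_integrable_mul].
rewrite (weak_green o1 Lu1 Lg1 w1) (weak_green o2 Lu2 Lg2 w2) -RintegralD//; last 2 first.
- by apply: integrable_add; [|apply: integrable_scale]; exact: L2per_integrable_mul.
- by apply: integrable_add; [|apply: integrable_scale]; exact: L2per_integrable_mul.
by congr Rintegral; apply/funext => x; ring.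
Qed.

Lemma dual_form_energy : dual_form a b = energy L omega v1 v2 d1 d2.
Proof.
have o1 := force_odd_periodic oa ob; have o2 := force_odd_periodic ob oa.
have Lv1 := odd_periodic_L2per (green_odd_periodic o1);
  have Lv2 := odd_periodic_L2per (green_odd_periodic o2).
have Ld1 := dgreen_L2per o1; have Ld2 := dgreen_L2per o2.
rewrite /dual_form (pairing_green Lv1 Lv2 Ld1 Ld2 (weak_green_green o1)
  (weak_green_green o2)).
by congr Rintegral; apply/funext => x; rewrite !expr2.
Qed.

Lemma energy_ge0 (a0 b0 a' b' : R -> R) : 0 <= energy L omega a0 b0 a' b'.
Proof.
apply: Rintegral_ge0 => x _.
have p (c d : R) : 0 <= c ^+ 2 + d ^+ 2 by rewrite addr_ge0 ?sqr_ge0.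
by apply: addr_ge0 => //; apply: mulr_ge0 => //; exact: sqr_ge0.
Qed.

(** The constraint integral of (a, b) is its energy inner product with (v1, v2),
    whose energy is the dual form: this is the Cauchy-Schwarz inequality. *)
Lemma dual_form_lower_bound (upsilon : R) a' b' : 0 < upsilon -> pnorm m a b = upsilon ->
  L2per L a' -> L2per L b' -> weak_derivative L a a' -> weak_derivative L b b' ->
  upsilon ^+ 2 <= dual_form a b * energy L omega a b a' b'.
Proof.
move=> u0 un La' Lb' wa wb.
have La := odd_periodic_L2per oa; have Lb := odd_periodic_L2per ob.
have o1 := force_odd_periodic oa ob; have o2 := force_odd_periodic ob oa.
have Lv1 := odd_periodic_L2per (green_odd_periodic o1);
  have Lv2 := odd_periodic_L2per (green_odd_periodic o2).
have Ld1 := dgreen_L2per o1; have Ld2 := dgreen_L2per o2.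
have E0 := energy_ge0 a b a' b'; have D0 := energy_ge0 v1 v2 d1 d2.
have eE := energy_integrable omega La Lb La' Lb'.
have eD := energy_integrable omega Lv1 Lv2 Ld1 Ld2.
have P := pairing_green La Lb La' Lb' wa wb.
have P0 : intc 0 L (fun x => frc a b x * a x + frc b a x * b x) = upsilon.
  by rewrite -un; congr Rintegral; apply/funext => x; exact: force_pairing.
rewrite P0 in P.
rewrite dual_form_energy.
set E := energy _ _ _ _ _ _ in E0 *; set D := energy _ _ _ _ _ _ in D0 *.
(* The optimal weight is l = upsilon / D. *)
have W (l : R) : 0 < l -> 2 * upsilon <= l * D + l^-1 * E.
  move=> l0; rewrite P /D /E /energy -!RintegralZl//; last first.
    by apply: integrable_add; [|apply: integrable_scale]; apply: integrable_add;
      exact: L2per_integrable_mul.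
  rewrite -RintegralD//; [|exact: integrable_scale|exact: integrable_scale].
  apply: le_Rintegral => //.
  - by apply: integrable_scale; apply: integrable_add; [|apply: integrable_scale];
    apply: integrable_add; exact: L2per_integrable_mul.
  - by apply: integrable_add; exact: integrable_scale.
  move=> x _.
  have AG (p q : R) : 2 * (p * q) <= l * p ^+ 2 + l^-1 * q ^+ 2.
    rewrite -subr_ge0 (_ : _ - _ = l^-1 * (l * p - q) ^+ 2).
      by rewrite mulr_ge0 ?sqr_ge0// invr_ge0 ltW.
    by field; rewrite gt_eqF.
  have om0 : 0 <= omega by rewrite /omega sqr_ge0.
  have A1 := AG (d1 x) (a' x); have A2 := AG (d2 x) (b' x).
  have A3 := ler_wpM2l om0 (AG (v1 x) (a x)); have A4 := ler_wpM2l om0 (AG (v2 x) (b x)).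
  lra.
have [D1|] := ltP 0 D.
  have := W (upsilon / D) (divr_gt0 u0 D1); rewrite divfK ?gt_eqF// invf_div => W1.
  have : upsilon <= D / upsilon * E by lra.
  by rewrite mulrAC ler_pdivlMr// -expr2.
move=> D1; have {D1}DE : D = 0 by apply/le_anti; rewrite D1 D0.
have E1 : 0 < E + 1 by lra.
have := W ((E + 1) / upsilon) (divr_gt0 E1 u0); rewrite DE mulr0 add0r invf_div.
rewrite mulrAC -mulrA => W1.
have : E / (E + 1) <= 1 by rewrite ler_pdivrMr// mul1r; lra.
by move=> /(ler_wpM2l (ltW u0)); rewrite mulr1; lra.
Qed.

(** Let t normalize (v1, v2). The dual form D is the pairing of the force with
    (v1, v2), so Young's inequality applied to (a, b) and (t v1, t v2), which
    satisfy the same constraint, gives t D <= upsilon. The energy of the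
    normalized pair is t^2 D. *)
Lemma improved_competitor (upsilon : R) : 0 < upsilon -> pnorm m a b = upsilon ->
  0 < dual_form a b ->
  exists2 t : R, 0 < t & pnorm m (fun x => t * v1 x) (fun x => t * v2 x) = upsilon /\
    energy L omega (fun x => t * v1 x) (fun x => t * v2 x) (fun x => t * d1 x)
      (fun x => t * d2 x)
      <= upsilon ^+ 2 / dual_form a b.
Proof.
move=> u0 un D0.
have o1 := force_odd_periodic oa ob; have o2 := force_odd_periodic ob oa.
have ov1 := green_odd_periodic o1; have ov2 := green_odd_periodic o2.
have Lv1 := odd_periodic_L2per ov1; have Lv2 := odd_periodic_L2per ov2.
have Ld1 := dgreen_L2per o1; have Ld2 := dgreen_L2per o2.
have [cv1 pv1 _] := ov1; have [cv2 pv2 _] := ov2.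
have [ca _ _] := oa; have [cb _ _] := ob.
have pint f g n : continuous f -> continuous g ->
  mu.-integrable `[0, L] (EFin \o (fun x => (f x ^+ 2 + g x ^+ 2) ^+ n)).
  by move=> cf cg; apply: continuous_integrable; exact: continuous_sqrsum.
have T0 : 0 < pnorm m v1 v2.
  rewrite lt0r; apply/andP; split; last first.
    by apply: Rintegral_ge0 => x _; rewrite exprn_ge0// addr_ge0 ?sqr_ge0.
  apply/eqP => T0.
  have Z := periodic_ge0_int0 L0 (@continuous_sqrsum m.+1 _ _ cv1 cv2) _ _ T0.
  have {}Z x : v1 x = 0 /\ v2 x = 0.
    have : (v1 x ^+ 2 + v2 x ^+ 2) ^+ m.+1 = 0.
      apply: Z => y; first by rewrite /= pv1 pv2.
      by rewrite exprn_ge0// addr_ge0 ?sqr_ge0.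
    move/eqP; rewrite expf_eq0/= paddr_eq0 ?sqr_ge0// !sqrf_eq0.
    by move=> /andP[/eqP -> /eqP ->].
  have : dual_form a b = intc 0 L (fun=> 0).
    by congr Rintegral; apply/funext => x; have [-> ->] := Z x; rewrite !mulr0 addr0.
  by rewrite int_cst ?(ltW L0)// mul0r => D00; move: D0; rewrite D00 ltxx.
have [t t0 tE] := root_exists (m.*2.+1) (divr_gt0 u0 T0).
have tn : pnorm m (fun x => t * v1 x) (fun x => t * v2 x) = upsilon.
  rewrite /pnorm; have -> : (fun x => ((t * v1 x) ^+ 2 + (t * v2 x) ^+ 2) ^+ m.+1) =
      fun x => t ^+ m.*2.+2 * (v1 x ^+ 2 + v2 x ^+ 2) ^+ m.+1.
    apply/funext => x; rewrite !exprMn -mulrDr exprMn -exprM; congr (t ^+ _ * _).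
    by rewrite mul2n.
  rewrite RintegralZl//; last exact: pint.
  by rewrite tE divfK// gt_eqF.
exists t => //; split => //.
have -> : energy L omega (fun x => t * v1 x) (fun x => t * v2 x) (fun x => t * d1 x)
  (fun x => t * d2 x)
    = t ^+ 2 * dual_form a b.
  rewrite dual_form_energy /energy -RintegralZl//; last exact: energy_integrable.
  by congr Rintegral; apply/funext => x; ring.
have tD : t * dual_form a b <= upsilon.
  have Y : m.+1.*2%:R * (t * dual_form a b) <= m.+1.*2%:R * upsilon.
    have -> : m.+1.*2%:R * upsilon = m.*2.+1%:R * upsilon + upsilon.
      by rewrite doubleS -[in LHS]natr1 mulrDl mul1r.
    rewrite -[X in _ <= _ + X]tn -{1}un /dual_form /pnorm.
    have if1 : mu.-integrable `[0, L] (EFin \o (fun x => frc a b x * v1 x +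
      frc b a x * v2 x)).
      by apply: integrable_add; apply: L2per_integrable_mul => //;
        exact: odd_periodic_L2per.
    have ctv1 : continuous (fun x => t * v1 x) by apply: continuous_mul => //;
      exact: continuous_const.
    have ctv2 : continuous (fun x => t * v2 x) by apply: continuous_mul => //;
      exact: continuous_const.
    rewrite -!RintegralZl//; [|exact: pint|exact: integrable_scale].
    rewrite -RintegralD//; [|by apply: integrable_scale; exact: pint|exact: pint].
    apply: le_Rintegral => //.
    - by apply: integrable_scale; exact: integrable_scale.
    - by apply: integrable_add; [apply: integrable_scale|]; exact: pint.
    move=> x _.
    have := young_pair m (a x) (b x) (t * v1 x) (t * v2 x).
    rewrite /force [b x ^+ 2 + _]addrC; apply: le_trans.
    by rewrite le_eqVlt; apply/orP; left; apply/eqP; ring.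
  by move: Y; rewrite ler_pM2l// ltr0n.
rewrite ler_pdivlMr// -mulrA -expr2 -exprMn lerXn2r// nnegrE;
  first by rewrite mulr_ge0 ?ltW.
exact: ltW.
Qed.

(** Equality in the Cauchy-Schwarz inequality: the energy of
    (v1, v2) - upsilon / E (a, b) is zero. *)
Lemma green_proportional (upsilon : R) a' b' : 0 < upsilon -> pnorm m a b = upsilon ->
  L2per L a' -> L2per L b' -> weak_derivative L a a' -> weak_derivative L b b' ->
  let E := energy L omega a b a' b' in 0 < E -> dual_form a b * E = upsilon ^+ 2 ->
  (forall x, v1 x = upsilon / E * a x) /\ (forall x, v2 x = upsilon / E * b x).
Proof.
move=> u0 un La' Lb' wa wb E E0 DE.
have [ca pa _] := oa; have [cb pb _] := ob.
have La := odd_periodic_L2per oa; have Lb := odd_periodic_L2per ob.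
have o1 := force_odd_periodic oa ob; have o2 := force_odd_periodic ob oa.
have ov1 := green_odd_periodic o1; have ov2 := green_odd_periodic o2.
have [cv1 pv1 _] := ov1; have [cv2 pv2 _] := ov2.
have Lv1 := odd_periodic_L2per ov1; have Lv2 := odd_periodic_L2per ov2.
have Ld1 := dgreen_L2per o1; have Ld2 := dgreen_L2per o2.
have P := pairing_green La Lb La' Lb' wa wb.
have P0 : intc 0 L (fun x => frc a b x * a x + frc b a x * b x) = upsilon.
  by rewrite -un; congr Rintegral; apply/funext => x; exact: force_pairing.
rewrite P0 in P.
have eE := energy_integrable omega La Lb La' Lb'.
have eD := energy_integrable omega Lv1 Lv2 Ld1 Ld2.
set t := upsilon / E.
pose q x := (v1 x - t * a x) ^+ 2 + (v2 x - t * b x) ^+ 2.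
have cq : continuous q.
  by apply: continuous_add; apply: continuous_pow; apply: continuous_sub => //;
    apply: continuous_mul => //; exact: continuous_const.
have iq := continuous_integrable 0 L cq.
have q0 x : 0 <= q x by rewrite addr_ge0 ?sqr_ge0.
have Dv : dual_form a b = upsilon ^+ 2 / E by rewrite -DE mulfK// gt_eqF.
have om0 : 0 < omega by rewrite /omega exprn_gt0.
have iq0 : intc 0 L q = 0.
  pose pd x := d1 x * a' x + d2 x * b' x + omega * (v1 x * a x + v2 x * b x).
  pose eE' x := a' x ^+ 2 + b' x ^+ 2 + omega * (a x ^+ 2 + b x ^+ 2).
  pose eD' x := d1 x ^+ 2 + d2 x ^+ 2 + omega * (v1 x ^+ 2 + v2 x ^+ 2).
  have ip : mu.-integrable `[0, L] (EFin \o pd).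
    by apply: integrable_add; [|apply: integrable_scale]; apply: integrable_add;
      exact: L2per_integrable_mul.
  have ipt := integrable_scale (2 * t) ip; have iEt := integrable_scale (t ^+ 2) eE.
  have iDp := integrable_diff eD ipt.
  have K : intc 0 L (fun x => eD' x - 2 * t * pd x + t ^+ 2 * eE' x) = 0.
    rewrite RintegralD// RintegralB// !RintegralZl//.
    have -> : intc 0 L eD' = upsilon ^+ 2 / E by rewrite -Dv dual_form_energy.
    by rewrite -P -[intc 0 L eE']/E /t; field; rewrite gt_eqF.
  apply/le_anti; rewrite Rintegral_ge0 ?andbT//.
  rewrite -(pmulr_rle0 _ om0) -RintegralZl// -[leRHS]K.
  apply: le_Rintegral; [by []|exact: integrable_scale|exact: integrable_add|].
  move=> x _; rewrite -subr_ge0 /q /eD' /pd /eE'.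
  rewrite (_ : _ - _ = (d1 x - t * a' x) ^+ 2 + (d2 x - t * b' x) ^+ 2).
    by rewrite addr_ge0 ?sqr_ge0.
  by ring.
have qE := periodic_ge0_int0 L0 cq _ q0 iq0.
have {}qE x : q x = 0 by apply: qE => y; rewrite /q pv1 pv2 pa pb.
by split=> x; have /eqP := qE x; rewrite paddr_eq0 ?sqr_ge0// !sqrf_eq0 !subr_eq0 =>
  /andP[/eqP e1 /eqP e2].
Qed.

End Pair.
End Data.
End Variational.

(** * Continuity of the functionals and moduli of continuity on the line *)

Section Continuity.
Local Open Scope classical_set_scope.
Context {R : realType}.
Implicit Types (f g h a b : R -> R) (x y L : R).
Notation mu := (@lebesgue_measure R).
Local Notation "'intc' a b f" := (\int[mu]_(x in `[a, b]) f x)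
  (at level 10, a, b, f at level 9).
Lemma cvg_int_bounded L (f_ : nat -> R -> R) f (A : R) : (forall n, continuous (f_ n)) ->
  (forall n x, 0 <= x <= L -> `|f_ n x| <= A) ->
  (forall x, 0 <= x <= L -> f_ n x @[n --> \oo] --> f x) ->
  intc 0 L (f_ n) @[n --> \oo] --> intc 0 L f.
Proof.
move=> cf fA ff.
have := dominated_cvg_mul (integrable_cst 0 L 1) cf fA ff.
have E g : intc 0 L ((fun=> 1) \* g) = intc 0 L g.
  by congr Rintegral; apply/funext => x; rewrite /= mul1r.
by rewrite E; under eq_fun do rewrite E.
Qed.

Lemma cvg_exprn (u : nat -> R) (l : R) k : u n @[n --> \oo] --> l ->
  u n ^+ k @[n --> \oo] --> l ^+ k.
Proof.
move=> ul; elim: k => [|k IH]; first by under eq_fun do rewrite expr0; exact: cvg_cst.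
by rewrite exprS; under eq_fun do rewrite exprS; exact: cvgM.
Qed.

Lemma cvg_sqrsum (a_ b_ : nat -> R -> R) a b k x : a_ n x @[n --> \oo] --> a x ->
  b_ n x @[n --> \oo] --> b x ->
  (a_ n x ^+ 2 + b_ n x ^+ 2) ^+ k @[n --> \oo] --> (a x ^+ 2 + b x ^+ 2) ^+ k.
Proof.
by move=> ca cb; apply: cvg_exprn; apply: cvgD; exact: cvg_exprn.
Qed.

Lemma sqrsum_bound (A p q : R) k : `|p| <= A -> `|q| <= A ->
  `|(p ^+ 2 + q ^+ 2) ^+ k| <= (A ^+ 2 + A ^+ 2) ^+ k.
Proof.
move=> pA qA; have A0 : 0 <= A by exact: le_trans pA.
rewrite ger0_norm ?exprn_ge0 ?addr_ge0 ?sqr_ge0//.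
rewrite lerXn2r ?nnegrE ?addr_ge0 ?sqr_ge0//.
by rewrite -(real_normK (num_real p)) -(real_normK (num_real q)) lerD// lerXn2r ?nnegrE.
Qed.

Section Limit.
Variables (L s : R) (m : nat).
Hypotheses (L0 : 0 < L) (s0 : 0 < s).

Lemma cvg_pnorm (a_ b_ : nat -> R -> R) (a b : R -> R) (A : R) :
  (forall n, odd_periodic L (a_ n)) -> (forall n, odd_periodic L (b_ n)) ->
  (forall n x, 0 <= x <= L -> `|a_ n x| <= A) ->
  (forall n x, 0 <= x <= L -> `|b_ n x| <= A) ->
  (forall x, 0 <= x <= L -> a_ n x @[n --> \oo] --> a x) ->
  (forall x, 0 <= x <= L -> b_ n x @[n --> \oo] --> b x) ->
  pnorm L m (a_ n) (b_ n) @[n --> \oo] --> pnorm L m a b.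
Proof.
move=> oa_ ob_ bda bdb cva cvb.
apply: (@cvg_int_bounded L (fun n x => (a_ n x ^+ 2 + b_ n x ^+ 2) ^+ m.+1)
  (fun x => (a x ^+ 2 + b x ^+ 2) ^+ m.+1) ((A ^+ 2 + A ^+ 2) ^+ m.+1)).
- by move=> n; apply: continuous_sqrsum; [have [] := oa_ n|have [] := ob_ n].
- by move=> n x xL; apply: sqrsum_bound; [exact: bda|exact: bdb].
- by move=> x xL; apply: cvg_sqrsum; [exact: cva|exact: cvb].
Qed.

Lemma cvg_force_green (a_ b_ : nat -> R -> R) (a b : R -> R) (A : R) :
  (forall n, odd_periodic L (a_ n)) -> (forall n, odd_periodic L (b_ n)) ->
  odd_periodic L a -> odd_periodic L b ->
  (forall n x, 0 <= x <= L -> `|a_ n x| <= A) ->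
  (forall n x, 0 <= x <= L -> `|b_ n x| <= A) ->
  (forall x, 0 <= x <= L -> a_ n x @[n --> \oo] --> a x) ->
  (forall x, 0 <= x <= L -> b_ n x @[n --> \oo] --> b x) ->
  intc 0 L (fun x => force m (a_ n) (b_ n) x * green s L (force m (a_ n)
    (b_ n)) x) @[n --> \oo] -->
  intc 0 L (fun x => force m a b x * green s L (force m a b) x).
Proof.
move=> oa_ ob_ oa ob bda bdb cva cvb.
have of_ n := force_odd_periodic m (oa_ n) (ob_ n).
have o := force_odd_periodic m oa ob.
pose F := (A ^+ 2 + A ^+ 2) ^+ m * A.
have bf n x : 0 <= x <= L -> `|force m (a_ n) (b_ n) x| <= F.
  move=> xL; rewrite /force normrM; apply: ler_pM => //; last exact: bda.
  by apply: sqrsum_bound; [exact: bda|exact: bdb].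
have cf x : 0 <= x <= L -> force m (a_ n) (b_ n) x @[n --> \oo] --> force m a b x.
  by move=> xL; apply: cvgM; [apply: cvg_sqrsum; [exact: cva|exact: cvb]|exact: cva].
have [C bC] := green_bound s0 L0.
have cfn n : continuous (force m (a_ n) (b_ n)) by have [] := of_ n.
have cfl : continuous (force m a b) by have [] := o.
apply: (@cvg_int_bounded L (fun n x => force m (a_ n) (b_ n) x * green s L (force m
  (a_ n) (b_ n)) x)
  (fun x => force m a b x * green s L (force m a b) x) (F * (C * F))).
- by move=> n; apply: continuous_mul => //; exact: continuous_green.
- move=> n x xL; rewrite normrM; apply: ler_pM => //; first exact: bf.
  by apply: bC => // t tL; exact: bf.
- move=> x xL; apply: cvgM; first exact: cf.
  exact: (@cvg_green _ s L L0 (fun n => force m (a_ n) (b_ n))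
    (force m a b) F cfl cfn bf cf x xL).
Qed.

Lemma cvg_dual_form (a_ b_ : nat -> R -> R) (a b : R -> R) (A : R) :
  (forall n, odd_periodic L (a_ n)) -> (forall n, odd_periodic L (b_ n)) ->
  odd_periodic L a -> odd_periodic L b ->
  (forall n x, 0 <= x <= L -> `|a_ n x| <= A) ->
  (forall n x, 0 <= x <= L -> `|b_ n x| <= A) ->
  (forall x, 0 <= x <= L -> a_ n x @[n --> \oo] --> a x) ->
  (forall x, 0 <= x <= L -> b_ n x @[n --> \oo] --> b x) ->
  dual_form L s m (a_ n) (b_ n) @[n --> \oo] --> dual_form L s m a b.
Proof.
move=> oa_ ob_ oa ob bda bdb cva cvb.
have dualE (f g : R -> R) : odd_periodic L f -> odd_periodic L g -> dual_form L s m f g =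
    intc 0 L (fun x => force m f g x * green s L (force m f g) x) +
    intc 0 L (fun x => force m g f x * green s L (force m g f) x).
  move=> of_ og; have o1 := force_odd_periodic m of_ og;
    have o2 := force_odd_periodic m og of_.
  have ci h : odd_periodic L h -> mu.-integrable `[0, L] (EFin \o
    (fun x => h x * green s L h x)).
    move=> [ch _ _]; apply: continuous_integrable; apply: continuous_mul => //;
      exact: continuous_green.
  by rewrite /dual_form RintegralD//; exact: ci.
rewrite dualE//; under eq_fun do rewrite dualE//.
by apply: cvgD; apply: (@cvg_force_green _ _ _ _ A).
Qed.
End Limit.

Section Cluster.
Import ArrowAsProduct.

(** Tychonoff's theorem provides a cluster point of the sequence for pointwise
    convergence. *)
Lemma cluster_functions (U : nat -> bool * R -> R) (A : R) : (forall n i, `|U n i| <= A) ->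
  exists p : bool * R -> R, forall (r : seq (bool * R)) (e : R) N, 0 < e ->
    exists2 n, (N <= n)%N & forall i, i \in r -> `|p i - U n i| < e.
Proof.
move=> UA.
have FA : (U @ \oo) [set f : bool * R -> R | forall i, `[- A, A]%classic (f i)].
  by exists 0%N => // n _ i; rewrite /= in_itv/= -ler_norml.
have [p [_ clp]] := @tychonoff (bool * R)%type (fun=> R) (fun=> `[- A, A]%classic)
  (fun=> @segment_compact R _ _) (U @ \oo) _ FA.
exists p => r e N e0.
have near_p : nbhs p [set u : bool * R -> R | forall i, i \in r -> `|p i - u i| < e].
  elim: r => [|i r IH]; first by apply: (filterS _ filterT) => u _ i; rewrite in_nil.
  have near_i : nbhs p [set u : bool * R -> R | `|p i - u i| < e].
    have := @proj_continuous (bool * R)%type (fun=> R) i p.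
    by move=> /(@cvgr_dist_lt _ _ _ _ _ _ _) /(_ e e0).
  apply: filterS2 near_i IH => u h1 h2 j.
  by rewrite inE => /predU1P[->|/h2].
have FN : (U @ \oo) (U @` [set n | (N <= n)%N]).
  by exists N => // n /= Nn; exists n.
have [u [[n Nn <-] un]] := clp _ _ FN near_p.
by exists n.
Qed.

End Cluster.

Section Subsequence.
Variables (L : R) (L0 : 0 < L).

Lemma periodic_int f (k : int) x : periodic f L -> f (x + L * k%:~R) = f x.
Proof.
move=> pf.
have pn (n : nat) y : f (y + L * n%:R) = f y.
  elim: n y => [|n IH] y; first by rewrite mulr0 addr0.
  by rewrite -natr1 mulrDr mulr1 addrA pf.
case: k => n; first by rewrite -pmulrn pn.
rewrite NegzE mulrNz mulrN; rewrite -[in RHS](subrK (L * n.+1%:R) x) pn.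
by rewrite -pmulrn.
Qed.

Lemma periodize_id f : periodic f L -> periodize L f =1 f.
Proof. by move=> pf x; rewrite /periodize -mulrN -intrN periodic_int. Qed.

Lemma periodize_dom x : 0 <= x - L * (Num.floor (x / L))%:~R < L.
Proof.
have /andP[h1 h2] := floor_itv (x / L).
rewrite ler_pdivlMr// ltr_pdivrMr// in h1 h2; rewrite intrD in h2.
by apply/andP; split; lra.
Qed.

Lemma periodic_bound f (A : R) : periodic f L -> (forall x, 0 <= x <= L -> `|f x| <= A) ->
  forall x, `|f x| <= A.
Proof.
move=> pf fA x; rewrite -(periodize_id pf); apply: fA.
by have /andP[-> /ltW] := periodize_dom x.
Qed.

(** Two nearby points may be separated by a point of the lattice L Z, through
    which the increment is then split. *)
Lemma periodic_modulus f (e d : R) : periodic f L ->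
  (forall x y, 0 <= x -> x <= y -> y <= L -> y - x <= d -> `|f y - f x| <= e) ->
  forall x y, x <= y -> y - x <= d -> y - x <= L -> `|f y - f x| <= e + e.
Proof.
move=> pf fe x y xy yd yL.
set k : int := Num.floor (x / L).
have /andP[x0 xL] := periodize_dom x; rewrite -/k in x0 xL.
have E z : f z = f (z - L * k%:~R) by rewrite -mulrN -intrN periodic_int.
rewrite (E x) (E y).
have e0 : 0 <= e.
  apply: le_trans (fe _ _ x0 (lexx _) (ltW xL) _); first exact: normr_ge0.
  by rewrite subrr; lra.
have [yk|yk] := leP (y - L * k%:~R) L.
  by apply: (@le_trans _ _ e); [apply: fe => //; lra|rewrite lerDl].
have -> : f (y - L * k%:~R) = f (y - L * k%:~R - L)
  by rewrite -[in LHS](subrK L (y - _)) pf.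
have fL : f L = f 0 by rewrite -[L in LHS]add0r pf.
have h1 : `|f L - f (x - L * k%:~R)| <= e by apply: fe => //; lra.
have h2 : `|f (y - L * k%:~R - L) - f 0| <= e by apply: fe => //; lra.
rewrite -fL in h2; have -> : f (y - L * k%:~R - L) - f (x - L * k%:~R) =
  (f (y - L * k%:~R - L) - f L) + (f L - f (x - L * k%:~R)) by ring.
by apply: le_trans (ler_normD _ _) _; rewrite lerD.
Qed.

End Subsequence.
End Continuity.

(** * Compactness of sequences of bounded energy *)

Section Compactness.
Local Open Scope classical_set_scope.
Context {R : realType}.
Implicit Types (f g h a b : R -> R) (x y L : R).
Notation mu := (@lebesgue_measure R).
Local Notation "'intc' a b f" := (\int[mu]_(x in `[a, b]) f x)
  (at level 10, a, b, f at level 9).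
Lemma eq_of_dist_le (p q : R) : (forall e, 0 < e -> `|p - q| <= e) -> p = q.
Proof.
move=> h; apply/eqP; rewrite -subr_eq0 -normr_le0; apply/ler_addgt0Pr => e e0.
by rewrite add0r h.
Qed.

Lemma dist_three (e p q r t : R) : `|p - q| <= e / 3 -> `|q - r| <= e / 3 ->
  `|t - r| <= e / 3 -> `|p - t| <= e.
Proof. by rewrite !ler_norml => /andP[? ?] /andP[? ?] /andP[? ?]; apply/andP; split;
  lra. Qed.

(** The Arzela-Ascoli theorem for odd periodic functions, indexed by a boolean
    so that one subsequence serves both components of a complex function. A
    cluster point u for pointwise convergence inherits oddness, periodicity and
    the modulus of continuity, and the k-th term of the subsequence is chosen
    1/(k+1)-close to u on a grid of mesh L/(k+1). *)
Lemma subsequence_of_equicontinuous L (U : nat -> bool -> R -> R) (A : R) : 0 < L ->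
  (forall n c, odd_periodic L (U n c)) ->
  (forall n c x, 0 <= x <= L -> `|U n c x| <= A) ->
  (forall e, 0 < e -> exists2 d : R, 0 < d & forall n c x y, 0 <= x -> x <= y -> y <= L ->
     y - x <= d -> `|U n c y - U n c x| <= e) ->
  exists (phi : nat -> nat) (u : bool -> R -> R), [/\ forall k, (k <= phi k)%N,
    forall c, odd_periodic L (u c) &
    forall c x, 0 <= x <= L -> U (phi k) c x @[k --> \oo] --> u c x].
Proof.
move=> L0 oU bU eU.
have gU n i : `|(fun i : bool * R => U n i.1 i.2) i| <= A.
  case: i => c x /=; have [_ pU _] := oU n c.
  by apply: (periodic_bound L0 pU) => y yL; exact: bU.
have [p clp] := cluster_functions gU.
pose u c x := p (c, x).
have {}clp (r : seq (bool * R)) (e : R) N : 0 < e ->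
    exists2 n, (N <= n)%N & forall c x, (c, x) \in r -> `|u c x - U n c x| < e.
  move=> e0; have [n Nn h] := clp r e N e0.
  by exists n => // c x /h.
have pair c x y (e : R) : 0 < e -> exists n, `|u c x - U n c x| < e /\ `|u c y - U n c y|
  < e.
  move=> e0; have [n _ h] := clp [:: (c, x); (c, y)] e 0%N e0.
  by exists n; split; apply: h; rewrite !inE eqxx ?orbT.
have oddu c x : u c (- x) = - u c x.
  apply: eq_of_dist_le => e e0; have e2 : 0 < e / 2 by rewrite divr_gt0.
  have [n []] := pair c (- x) x _ e2; have [_ _ ->] := oU n c.
  rewrite !ltr_norml ler_norml => /andP[? ?] /andP[? ?]; apply/andP; split; lra.
have peru c : periodic (u c) L.
  move=> x; apply: eq_of_dist_le => e e0; have e2 : 0 < e / 2 by rewrite divr_gt0.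
  have [n []] := pair c (x + L) x _ e2; have [_ -> _] := oU n c.
  rewrite !ltr_norml ler_norml => /andP[? ?] /andP[? ?]; apply/andP; split; lra.
have modU e : 0 < e -> exists2 d : R, 0 < d & forall n c x y, x <= y ->
     y - x <= d -> `|U n c y - U n c x| <= e.
  move=> e0; have e2 : 0 < e / 2 by rewrite divr_gt0.
  have [d d0 H] := eU _ e2.
  exists (Num.min d L); first by rewrite lt_min d0.
  move=> n c x y xy; rewrite le_min => /andP[yd yL].
  have [_ pU _] := oU n c.
  rewrite [e]splitr; apply: (periodic_modulus L0 pU _ xy yd yL).
  by move=> *; exact: H.
have modu e : 0 < e -> exists2 d : R, 0 < d & forall c x y, x <= y ->
     y - x <= d -> `|u c y - u c x| <= e.
  move=> e0; have [d d0 H] := modU _ e0.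
  exists d => // c x y xy yd; apply/ler_addgt0Pr => t t0.
  have t2 : 0 < t / 2 by rewrite divr_gt0.
  have [n []] := pair c x y _ t2; have := H n c x y xy yd.
  rewrite !ltr_norml !ler_norml => /andP[? ?] /andP[? ?] /andP[? ?]; apply/andP; split; lra.
have contu c : continuous (u c).
  move=> x; apply/(@cvgrPdist_le _ R^o) => e e0; have [d d0 H] := modu _ e0.
  near=> y.
  have : `|x - y| < d.
    by near: y; apply: (@cvgr_dist_lt _ _ _ (nbhs x) _ id x) => //; exact: cvg_id.
  rewrite ltr_norml => /andP[d1 d2].
  have [xy|/ltW yx] := leP x y; first by rewrite distrC; apply: H => //; lra.
  by apply: H => //; lra.
pose grid k : seq (bool * R) :=
  [seq (c, L * j%:R / k.+1%:R) | c <- [:: true; false], j <- iota 0 k.+2].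
have phi_ex k : exists n, (k <= n)%N /\
    forall c x, (c, x) \in grid k -> `|u c x - U n c x| < k.+1%:R^-1.
  have [|n kn h] := clp (grid k) k.+1%:R^-1 k; first by rewrite invr_gt0.
  by exists n.
have [phi phiP] := choice phi_ex.
exists phi, u; split; [by move=> k; have [] := phiP k|by []|].
move=> c x /andP[x0 xL]; apply/(@cvgrPdist_le _ R^o) => e e0.
have e3 : 0 < e / 3 by rewrite divr_gt0.
have [d d0 Hu] := modu _ e3; have [d' d'0 HU] := modU _ e3.
have dd : 0 < Num.min d d' / L by rewrite divr_gt0// lt_min d0.
near=> k.
have k1 : (k.+1%:R^-1 : R) < e / 3 by near: k; exact: near_infty_natSinv_lt (PosNum e3).
have kd : (k.+1%:R^-1 : R) < Num.min d d' / L.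
  near: k; exact: near_infty_natSinv_lt (PosNum dd).
rewrite ltr_pdivlMr// mulrC lt_min in kd; have /andP[kd1 kd2] := kd.
pose j := Num.truncn (x * k.+1%:R / L).
have /andP[j1 j2] : j%:R <= x * k.+1%:R / L < j.+1%:R.
  by apply: truncn_itv; rewrite divr_ge0 ?(ltW L0)// mulr_ge0.
rewrite ler_pdivlMr// in j1; rewrite ltr_pdivrMr// in j2.
pose xj := L * j%:R / k.+1%:R.
have xjx : xj <= x by rewrite /xj ler_pdivrMr// mulrC.
have xxj : x - xj <= L / k.+1%:R.
  rewrite lerBlDr /xj -mulrDl -[X in X + _]mulr1 -mulrDr ler_pdivlMr//.
  by rewrite (le_trans (ltW j2))// -natr1 addrC mulrC.
have jk : (j <= k.+1)%N.
  have : (j%:R : R) <= k.+1%:R.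
    rewrite -(ler_pM2r L0); apply: le_trans j1 _.
    by rewrite mulrC ler_wpM2l.
  by rewrite ler_nat.
have xjg : (c, xj) \in grid k.
  apply: (@allpairs_f _ _ _ (fun c j => (c, L * j%:R / k.+1%:R))).
    by case: c.
  by rewrite mem_iota add0n.
have [_ /(_ c xj xjg) h2] := phiP k.
have h1 := Hu c xj x xjx (le_trans xxj (ltW kd1)).
have h3 := HU (phi k) c xj x xjx (le_trans xxj (ltW kd2)).
exact: (dist_three h1 (ltW (lt_trans h2 k1)) h3).
Unshelve. all: by end_near. Qed.

(** Neither derivatives nor energies have to be passed to the limit: the lower
    bound of the dual form along the sequence survives, because the dual form is
    continuous for bounded pointwise convergence. *)
Lemma extremal_pair L s m (upsilon e : R) (a_ b_ a'_ b'_ : nat -> R -> R) : 0 < L ->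
  0 < s ->
  0 < upsilon -> 0 <= e ->
  (forall n, admissible L m upsilon (a_ n) (b_ n) (a'_ n) (b'_ n)) ->
  (forall n, energy L (s ^+ 2) (a_ n) (b_ n) (a'_ n) (b'_ n) <= e + n.+1%:R^-1) ->
  exists a b, [/\ odd_periodic L a, odd_periodic L b, pnorm L m a b = upsilon &
    upsilon ^+ 2 <= dual_form L s m a b * e].
Proof.
move=> L0 s0 u0 e0 adm En.
pose M := e + 1.
have inv1 n : (n.+1%:R^-1 : R) <= 1 by rewrite invf_le1// ler1n.
have EM n : energy L (s ^+ 2) (a_ n) (b_ n) (a'_ n) (b'_ n) <= M.
  by apply: le_trans (En n) _; rewrite /M lerD2l.
have part n (c : bool) : intc 0 L (fun t => (if c then a'_ n t else b'_ n t) ^+ 2) <= M.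
  have [oa ob La' Lb' _ _ _ _ _] := adm n.
  apply: le_trans (EM n); apply: le_Rintegral => //.
  - by case: c; [have [] := La'|have [] := Lb'].
  - by apply: energy_integrable => //; exact: odd_periodic_L2per.
  move=> t _.
  have p1 : 0 <= s ^+ 2 * (a_ n t ^+ 2 + b_ n t ^+ 2).
    by apply: mulr_ge0; [exact: sqr_ge0|rewrite addr_ge0 ?sqr_ge0].
  by case: c; have := sqr_ge0 (a'_ n t); have := sqr_ge0 (b'_ n t); lra.
pose U n c x := if c then a_ n x else b_ n x : R.
have oU n c : odd_periodic L (U n c) by have [oa ob _ _ _ _ _ _ _] := adm n; case: c.
have M1 : 0 < M + 1 by rewrite /M; lra.
have modU (eps : R) n c x y : 0 < eps -> 0 <= x -> x <= y -> y <= L ->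
     y - x <= eps ^+ 2 / (M + 1) -> `|U n c y - U n c x| <= eps.
  move=> eps0 x0 xy yL yx.
  have [oa ob La' Lb' _ _ ia ib _] := adm n.
  by case: c (part n c) => pM; rewrite /U ?ia ?ib//; apply: (equicontinuity _ pM).
(* At scale A the modulus of continuity exceeds L, which bounds U because U
   vanishes at 0. *)
pose A := (M + 1) * (L + 1).
have A0 : 0 < A by rewrite mulr_gt0// addr_gt0.
have bU n c x : 0 <= x <= L -> `|U n c x| <= A.
  move=> /andP[x0 xL]; have [_ _ oc] := oU n c.
  have U0 : U n c 0 = 0 by have := oc 0; rewrite oppr0 => h; lra.
  rewrite -[U n c x]subr0 -U0; apply: modU => //.
  rewrite subr0 (le_trans xL)//.
  have -> : A ^+ 2 / (M + 1) = (M + 1) * (L + 1) ^+ 2 by rewrite /A; field; rewrite gt_eqF.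
  by move: L0 e0; rewrite /M; nra.
have eU eps : 0 < eps -> exists2 d : R, 0 < d & forall n c x y, 0 <= x -> x <= y ->
  y <= L ->
     y - x <= d -> `|U n c y - U n c x| <= eps.
  move=> eps0; exists (eps ^+ 2 / (M + 1)); first by rewrite divr_gt0// exprn_gt0.
  by move=> *; exact: modU.
have [phi [u [phik ou cu]]] := subsequence_of_equicontinuous L0 oU bU eU.
have oat k : odd_periodic L (a_ (phi k)) := oU (phi k) true.
have obt k : odd_periodic L (b_ (phi k)) := oU (phi k) false.
have bat k x : 0 <= x <= L -> `|a_ (phi k) x| <= A := bU (phi k) true x.
have bbt k x : 0 <= x <= L -> `|b_ (phi k) x| <= A := bU (phi k) false x.
exists (u true), (u false); split; [exact: ou|exact: ou| |].
  have cp := @cvg_pnorm _ L m _ _ _ _ A oat obt bat bbt (cu true) (cu false).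
  have cst : pnorm L m (a_ (phi k)) (b_ (phi k)) @[k --> \oo] --> upsilon.
    under eq_fun do rewrite /pnorm (adm_norm (adm _)).
    exact: cvg_cst.
  exact: (cvg_unique (@Rhausdorff R) cp cst).
have cd := @cvg_dual_form _ L s m L0 s0 _ _ _ _ A oat obt (ou true) (ou false) bat bbt
  (cu true) (cu false).
have ce : dual_form L s m (a_ (phi k)) (b_ (phi k)) * (e + k.+1%:R^-1) @[k --> \oo] -->
    dual_form L s m (u true) (u false) * e.
  apply: cvgM; first exact: cd.
  have : e + k.+1%:R^-1 @[k --> \oo] --> e + 0 by apply: cvgD;
    [exact: cvg_cst|exact: cvg_harmonic].
  by rewrite addr0.
have cc : (fun _ : nat => upsilon ^+ 2) @ \oo --> upsilon ^+ 2 by exact: cvg_cst.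
apply: (ler_cvg_to cc ce); apply: nearW => k.
have [oa ob La' Lb' wa wb _ _ un] := adm (phi k).
apply: le_trans (dual_form_lower_bound L0 s0 oa ob u0 un La' Lb' wa wb) _.
apply: ler_wpM2l; first by rewrite dual_form_energy// energy_ge0.
apply: le_trans (En _) _; rewrite lerD2l lef_pV2 ?posrE ?ltr0Sn// ler_nat ltnS.
exact: phik.
Qed.

End Compactness.

(** * The minimizer and its Euler-Lagrange equation *)

Section Minimizer.
Local Open Scope classical_set_scope.
Context {R : realType}.
Implicit Types (f g h a b : R -> R) (x y L : R).
Notation mu := (@lebesgue_measure R).
Local Notation "'intc' a b f" := (\int[mu]_(x in `[a, b]) f x)
  (at level 10, a, b, f at level 9).
Lemma inf_attained (S : set R) (x0 : R) : S x0 -> (forall x, S x -> x0 <= x) -> inf S = x0.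
Proof.
move=> Sx0 lb; apply/le_anti/andP; split; first by apply: ge_inf => //; exists x0.
by apply: lb_le_inf => //; exists x0.
Qed.

Lemma pnormZ L m (c : R) a b : continuous a -> continuous b ->
  pnorm L m (fun x => c * a x) (fun x => c * b x) = c ^+ m.*2.+2 * pnorm L m a b.
Proof.
move=> ca cb; rewrite /pnorm -RintegralZl//; last first.
  by apply: continuous_integrable; exact: continuous_sqrsum.
congr Rintegral; apply/funext => x.
by rewrite !exprMn -mulrDr exprMn -exprM mul2n.
Qed.

Lemma energyZ L omega (c : R) a b a' b' : L2per L a -> L2per L b -> L2per L a' ->
  L2per L b' ->
  energy L omega (fun x => c * a x) (fun x => c * b x) (fun x => c * a' x)
    (fun x => c * b' x) =
  c ^+ 2 * energy L omega a b a' b'.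
Proof.
move=> La Lb La' Lb'; rewrite /energy -RintegralZl//; last exact: energy_integrable.
by congr Rintegral; apply/funext => x; ring.
Qed.

Lemma odd_periodicZ L (c : R) f : odd_periodic L f -> odd_periodic L (fun x => c * f x).
Proof.
move=> [cf pf of_]; split; first by apply: continuous_mul => //; exact: continuous_const.
- by move=> x; rewrite pf.
- by move=> x; rewrite of_ mulrN.
Qed.

Lemma admissibleZ L m upsilon (c : R) a b a' b' : admissible L m upsilon a b a' b' ->
  admissible L m (c ^+ m.*2.+2 * upsilon) (fun x => c * a x) (fun x => c * b x)
    (fun x => c * a' x) (fun x => c * b' x).
Proof.
move=> [oa ob La' Lb' wa wb ia ib un].
have incr f f' : L2per L f' -> (forall x y, 0 <= x -> x <= y -> y <= L ->
  f y - f x = intc x y f') ->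
    forall x y, 0 <= x -> x <= y -> y <= L -> c * f y - c * f x =
      intc x y (fun x => c * f' x).
  move=> Lf' h x y x0 xy yL.
  by rewrite RintegralZl//; [rewrite -h// mulrBr|exact: integrable_subitv
    (L2per_integrable Lf') x0 yL].
split; [exact: odd_periodicZ|exact: odd_periodicZ|exact: L2perZ|exact: L2perZ| | |
  exact: incr|exact: incr|].
- by apply: weak_derivativeZ => //; exact: odd_periodic_L2per.
- by apply: weak_derivativeZ => //; exact: odd_periodic_L2per.
- have [ca _ _] := oa; have [cb _ _] := ob.
  by rewrite -un; exact: pnormZ.
Qed.

Section Fix.
Variables (L s : R) (m : nat).
Hypotheses (L0 : 0 < L) (s0 : 0 < s).
Let omega := s ^+ 2.
Local Notation Om upsilon := (Omega L m.*2 omega upsilon).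

(** A multiple of sin (2 pi x / L). *)
Lemma Xset_nonempty (upsilon : R) : 0 < upsilon -> exists u, Xset L m.*2 upsilon u.
Proof.
move=> u0.
pose c : R := pi *+ 2 / L.
have cL : c * L = pi *+ 2 by rewrite /c divfK// gt_eqF.
pose f x : R := sin (c * x).
have df x : is_derive x 1 f (c * cos (c * x)).
  have := @is_derive_affine _ sin (cos (c * x + 0)) c 0 x (is_derive_sin _).
  by rewrite addr0; under eq_fun do rewrite addr0.
have cf : continuous f := is_derive_continuous df.
have ccos : continuous (fun x : R => c * cos (c * x)).
  apply: continuous_mul; first exact: continuous_const.
  have dcos x : is_derive x 1 (fun x : R => cos (c * x)) (c * - sin (c * x)).
    have := @is_derive_affine _ cos (- sin (c * x + 0)) c 0 x (is_derive_cos _).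
    by rewrite addr0; under eq_fun do rewrite addr0.
  exact: (is_derive_continuous dcos).
have pf : periodic f L by move=> x; rewrite /f mulrDr cL sinD2pi.
have of_ x : f (- x) = - f x by rewrite /f mulrN sinN.
have of0 : odd_periodic L f by [].
have z0 : odd_periodic L (fun=> 0 : R) by split => // [|x];
  [exact: continuous_const|rewrite oppr0].
have [cz pz _] := z0.
have T0 : 0 < pnorm L m f (fun=> 0).
  rewrite lt0r; apply/andP; split; last first.
    by apply: Rintegral_ge0 => x _; rewrite exprn_ge0// addr_ge0 ?sqr_ge0.
  apply/eqP => T0.
  have := periodic_ge0_int0 L0 (@continuous_sqrsum _ m.+1 _ _ cf cz) _ _ T0 (L / 4).
  have -> : f (L / 4) = 1.
    by rewrite /f (_ : c * (L / 4) = pi / 2) ?sin_pihalf// mulrA cL; lra.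
  rewrite expr0n addr0 !expr1n => h.
  have : (1 : R) = 0.
    apply: h => x; first by rewrite /= pf.
    by rewrite exprn_ge0// addr_ge0 ?sqr_ge0.
  by move/eqP; rewrite oner_eq0.
have [t t0 tE] := root_exists m.*2.+1 (divr_gt0 u0 T0).
have nE := pnormZ L m t cf cz; rewrite tE divfK ?gt_eqF// in nE.
have pc : periodic (fun x => t * (c * cos (c * x))) L.
  by move=> x; rewrite mulrDr cL cosD2pi.
have [Xu _] := @Xset_of_C1 _ L L0 m upsilon omega _ _ _ _ (odd_periodicZ t of0)
  (odd_periodicZ t z0)
  (fun x => is_derive_scale t (df x)) (fun x => is_derive_scale t
    (is_derive_const 0 x)) (continuous_mul (@continuous_const _ t) ccos)
  (continuous_mul (@continuous_const _ t) (@continuous_const _ 0)) pc (fun=> erefl) nE.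
by eexists; exact: Xu.
Qed.

Lemma Benergy_ge0 (upsilon : R) u : Xset L m.*2 upsilon u -> 0 <= Benergy L omega u.
Proof.
move=> Xu; have [a [b [a' [b' [_ E]]]]] := admissible_of_Xset L0 omega Xu.
have := energy_ge0 L s a b a' b'; rewrite -E; lra.
Qed.

Lemma Omega_le (upsilon : R) u : Xset L m.*2 upsilon u -> Om upsilon <= Benergy L omega u.
Proof.
move=> Xu; apply: ge_inf; last by exists u.
by exists 0 => _ [v Xv <-]; exact: Benergy_ge0 Xv.
Qed.

Lemma competitor_in_Xset (upsilon t : R) a b : odd_periodic L a -> odd_periodic L b ->
  let v1 := green s L (force m a b) in let v2 := green s L (force m b a) in
  let d1 := dgreen s L (force m a b) in let d2 := dgreen s L (force m b a) in
  pnorm L m (fun x => t * v1 x) (fun x => t * v2 x) = upsilon ->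
  Xset L m.*2 upsilon (fun x => (t * v1 x) +i* (t * v2 x)) /\
  2 * Benergy L omega (fun x => (t * v1 x) +i* (t * v2 x)) =
    energy L omega (fun x => t * v1 x) (fun x => t * v2 x) (fun x => t * d1 x)
      (fun x => t * d2 x).
Proof.
move=> oa ob v1 v2 d1 d2 tn.
have o1 := force_odd_periodic m oa ob; have o2 := force_odd_periodic m ob oa.
have [c1 p1 q1] := o1; have [c2 p2 q2] := o2.
have P1 : periodic (fun x => t * d1 x) L by move=> x; rewrite /d1 dgreen_periodic.
have P2 : periodic (fun x => t * d2 x) L by move=> x; rewrite /d2 dgreen_periodic.
exact: (@Xset_of_C1 _ L L0 m upsilon omega _ _ _ _
  (odd_periodicZ t (green_odd_periodic L0 s0 o1)) (odd_periodicZ t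
    (green_odd_periodic L0 s0 o2))
  (fun x => is_derive_scale t (is_derive_green s0 L0 x c1))
    (fun x => is_derive_scale t (is_derive_green s0 L0 x c2))
  (continuous_mul (@continuous_const _ t) (continuous_dgreen s0 c1)) (continuous_mul
    (@continuous_const _ t) (continuous_dgreen s0 c2)) P1 P2 tn).
Qed.

(** The improved competitor belongs to the constraint set. *)
Lemma Omega_le_dual_form (upsilon : R) a b : 0 < upsilon -> odd_periodic L a ->
  odd_periodic L b ->
  pnorm L m a b = upsilon -> 0 < dual_form L s m a b ->
  2 * Om upsilon <= upsilon ^+ 2 / dual_form L s m a b.
Proof.
move=> u0 oa ob un D0.
have [t t0 [tn tE]] := improved_competitor L0 s0 oa ob u0 un D0.
have [Xw Bw] := competitor_in_Xset oa ob tn.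
have Ow := Omega_le Xw.
by apply: le_trans tE; rewrite -Bw ler_pM2l.
Qed.

Lemma dual_form_gt0 (upsilon e : R) a b : 0 < upsilon -> odd_periodic L a ->
  odd_periodic L b ->
  upsilon ^+ 2 <= dual_form L s m a b * e -> 0 < dual_form L s m a b.
Proof.
move=> u0 oa ob lb.
rewrite lt0r dual_form_energy// energy_ge0 andbT -dual_form_energy//; apply/eqP => D0.
by move: lb; rewrite D0 mul0r leNgt exprn_gt0.
Qed.

(** By the two inequalities of the dual form D, the energy of (a, b) is at least
    upsilon^2 / D, which is at least the energy of a member of the constraint
    set. *)
Lemma Omega_le_energy (upsilon : R) a b a' b' : 0 < upsilon ->
  admissible L m upsilon a b a' b' ->
  2 * Om upsilon <= energy L omega a b a' b'.
Proof.
move=> u0 [oa ob La' Lb' wa wb _ _ un].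
have lb := dual_form_lower_bound L0 s0 oa ob u0 un La' Lb' wa wb.
have D0 := dual_form_gt0 u0 oa ob lb.
apply: le_trans (Omega_le_dual_form u0 oa ob un D0) _.
by rewrite ler_pdivrMr// mulrC.
Qed.

(** The fields [mp_eqa] and [mp_eqb] are the Euler-Lagrange equation in integral
    form, from which the regularity of (a, b) follows. *)
Record minimizing_pair (upsilon : R) a b : Prop := {
  mp_a : odd_periodic L a;
  mp_b : odd_periodic L b;
  mp_norm : pnorm L m a b = upsilon;
  mp_X : Xset L m.*2 upsilon (fun x => a x +i* b x);
  mp_B : Benergy L omega (fun x => a x +i* b x) = Om upsilon;
  mp_pos : 0 < Om upsilon;
  mp_eqa : forall x, a x = 2 * Om upsilon / upsilon * green s L (force m a b) x;
  mp_eqb : forall x, b x = 2 * Om upsilon / upsilon * green s L (force m b a) x }.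

(** The limit (a, b) of a minimizing sequence satisfies
    upsilon^2 <= D (2 Omega), where D is its dual form, so its improved competitor
    w has energy at most upsilon^2 / D <= 2 Omega and is a minimizer. For w the
    same two inequalities become equalities, and the equality case of the
    Cauchy-Schwarz inequality is the Euler-Lagrange equation. *)
Lemma minimizing_pair_exists (upsilon : R) : 0 < upsilon ->
  exists a b, minimizing_pair upsilon a b.
Proof.
move=> u0.
have [u1 Xu1] := Xset_nonempty u0.
have hinf : has_inf [set Benergy L omega u | u in Xset L m.*2 upsilon].
  split; first by exists (Benergy L omega u1), u1.
  by exists 0 => _ [v Xv <-]; exact: Benergy_ge0 Xv.
have O0 : 0 <= Om upsilon.
  by apply: lb_le_inf; [by case: hinf|move=> _ [v Xv <-]; exact: Benergy_ge0 Xv].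
have seqP n : exists q : (R -> R) * (R -> R) * (R -> R) * (R -> R),
    admissible L m upsilon q.1.1.1 q.1.1.2 q.1.2 q.2 /\
    energy L omega q.1.1.1 q.1.1.2 q.1.2 q.2 <= 2 * Om upsilon + n.+1%:R^-1.
  have e0 : 0 < (n.+1%:R^-1 : R) / 2 by rewrite divr_gt0// invr_gt0.
  have [_ [u Xu <-] uE] := inf_adherent e0 hinf.
  have [a [b [a' [b' [adm E]]]]] := admissible_of_Xset L0 omega Xu.
  exists (a, b, a', b'); split => //=; rewrite -E.
  have uE' : Benergy L omega u < Om upsilon + n.+1%:R^-1 / 2 := uE.
  rewrite (_ : 2 * Om upsilon + n.+1%:R^-1 = 2 * (Om upsilon + n.+1%:R^-1 / 2));
    last by field.
  by rewrite ler_pM2l// ltW.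
have [q qP] := choice seqP.
have O20 : 0 <= 2 * Om upsilon by rewrite mulr_ge0.
have [a [b [oa ob un lb]]] := extremal_pair L0 s0 u0 O20 (fun n => (qP n).1)
  (fun n => (qP n).2).
have D0 := dual_form_gt0 u0 oa ob lb.
have O1 : 0 < Om upsilon.
  rewrite lt0r O0 andbT; apply/eqP => Oz.
  by move: lb; rewrite Oz !mulr0 leNgt exprn_gt0.
have [t t0 [tn tE]] := improved_competitor L0 s0 oa ob u0 un D0.
have [Xw Bw] := competitor_in_Xset oa ob tn.
have o1 := force_odd_periodic m oa ob; have o2 := force_odd_periodic m ob oa.
have ov1 := green_odd_periodic L0 s0 o1; have ov2 := green_odd_periodic L0 s0 o2.
move: tn tE Xw Bw.
set w1 := (fun x => t * green s L (force m a b) x).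
set w2 := (fun x => t * green s L (force m b a) x).
set w1' := (fun x => t * dgreen s L (force m a b) x).
set w2' := (fun x => t * dgreen s L (force m b a) x).
move=> wn wE Xw Bw.
have Ew : energy L omega w1 w2 w1' w2' = 2 * Om upsilon.
  apply/le_anti; rewrite -{2}Bw ler_pM2l// Omega_le// andbT.
  by apply: le_trans wE _; rewrite ler_pdivrMr// mulrC.
have ow1 : odd_periodic L w1 by exact: odd_periodicZ.
have ow2 : odd_periodic L w2 by exact: odd_periodicZ.
have Lw1' : L2per L w1' by apply: L2perZ; exact: dgreen_L2per.
have Lw2' : L2per L w2' by apply: L2perZ; exact: dgreen_L2per.
have ww1 : weak_derivative L w1 w1'.
  by apply: weak_derivativeZ; [exact: odd_periodic_L2per|exact: dgreen_L2per|
    exact: weak_green_green].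
have ww2 : weak_derivative L w2 w2'.
  by apply: weak_derivativeZ; [exact: odd_periodic_L2per|exact: dgreen_L2per|
    exact: weak_green_green].
have lbw := dual_form_lower_bound L0 s0 ow1 ow2 u0 wn Lw1' Lw2' ww1 ww2.
have D0w := dual_form_gt0 u0 ow1 ow2 lbw.
have E0w : 0 < energy L omega w1 w2 w1' w2' by rewrite Ew mulr_gt0.
have DE : dual_form L s m w1 w2 * energy L omega w1 w2 w1' w2' = upsilon ^+ 2.
  apply/le_anti; rewrite lbw andbT Ew.
  by have := Omega_le_dual_form u0 ow1 ow2 wn D0w; rewrite (ler_pdivlMr _ _ D0w) mulrC.
have [g1 g2] := green_proportional L0 s0 ow1 ow2 u0 wn Lw1' Lw2' ww1 ww2 E0w DE.
rewrite -/omega Ew in g1 g2.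
have inv z : 2 * Om upsilon / upsilon * (upsilon / (2 * Om upsilon) * z) = z.
  by field; rewrite !gt_eqF.
exists w1, w2; split => //.
- by move: Bw; rewrite Ew => /(mulfI _); apply; rewrite pnatr_eq0.
- by move=> x; rewrite g1 inv.
- by move=> x; rewrite g2 inv.
Qed.

Section Equation.
Variables (upsilon : R) (a b : R -> R).
Hypotheses (u0 : 0 < upsilon) (mp : minimizing_pair upsilon a b).
Let theta := 2 * Om upsilon / upsilon.

(** The Lagrange multiplier theta is absorbed by the homogeneity of degree 2 m + 1
    of the nonlinearity. *)
Lemma rescaled_solution (kappa : R) : kappa ^+ m.*2 = theta ->
  solves_equation m.*2 omega (fun x => kappa%:C * (a x +i* b x)).
Proof.
move=> kE; have [oa ob un Xu Bu O0 ea eb] := mp.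
have o1 := force_odd_periodic m oa ob; have o2 := force_odd_periodic m ob oa.
have [c1 _ _] := o1; have [c2 _ _] := o2.
have reE : re_part (fun x => kappa%:C * (a x +i* b x)) = (fun x => kappa * a x).
  by apply/funext => x; rewrite /re_part /= mul0r subr0.
have imE : im_part (fun x => kappa%:C * (a x +i* b x)) = (fun x => kappa * b x).
  by apply/funext => x; rewrite /im_part /= mul0r addr0.
have aE : a = fun x => theta * green s L (force m a b) x by apply/funext.
have bE : b = fun x => theta * green s L (force m b a) x by apply/funext.
have da x : is_derive x 1 (fun x => kappa * a x) (kappa * (theta * dgreen s L
  (force m a b) x)).
  by rewrite {1}aE; apply: is_derive_scale; apply: is_derive_scale; exact: is_derive_green.
have db x : is_derive x 1 (fun x => kappa * b x) (kappa * (theta * dgreen s L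
  (force m b a) x)).
  by rewrite {1}bE; apply: is_derive_scale; apply: is_derive_scale; exact: is_derive_green.
have dda x : is_derive x 1 (fun x => kappa * (theta * dgreen s L (force m a b) x))
    (kappa * (theta * (s ^+ 2 * green s L (force m a b) x - force m a b x))).
  by apply: is_derive_scale; apply: is_derive_scale; exact: is_derive_dgreen.
have ddb x : is_derive x 1 (fun x => kappa * (theta * dgreen s L (force m b a) x))
    (kappa * (theta * (s ^+ 2 * green s L (force m b a) x - force m b a x))).
  by apply: is_derive_scale; apply: is_derive_scale; exact: is_derive_dgreen.
set u := (fun x => _).
have dre : re_part (deriveC u) = (fun x => kappa * (theta * dgreen s L (force m a b) x)).
  by rewrite -(derive1_fun da) -reE.
have dim : im_part (deriveC u) = (fun x => kappa * (theta * dgreen s L (force m b a) x)).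
  by rewrite -(derive1_fun db) -imE.
split.
- by move=> x; rewrite reE imE; split; [have [] := da x|have [] := db x].
- by move=> x; rewrite dre dim; split; [have [] := dda x|have [] := ddb x].
move=> x; rewrite /deriveC -/(deriveC u) dre dim (derive1_fun dda) (derive1_fun ddb).
rewrite cmod_even.
have -> : complex.Re (u x) = kappa * a x by rewrite -[LHS]/(re_part u x) reE.
have -> : complex.Im (u x) = kappa * b x by rewrite -[LHS]/(im_part u x) imE.
have nE : ((kappa * a x) ^+ 2 + (kappa * b x) ^+ 2) ^+ m = theta * (a x ^+ 2 +
  b x ^+ 2) ^+ m.
  by rewrite !exprMn -mulrDr exprMn -exprM mul2n kE.
rewrite nE /u; apply/eqP; rewrite eq_complex /=; apply/andP; split; apply/eqP.
- have -> : kappa * (theta * (s ^+ 2 * green s L (force m a b) x - force m a b x)) =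
      kappa * (s ^+ 2 * a x - theta * force m a b x) by rewrite (ea x) -/theta; ring.
  by rewrite /omega /force; ring.
- have -> : kappa * (theta * (s ^+ 2 * green s L (force m b a) x - force m b a x)) =
      kappa * (s ^+ 2 * b x - theta * force m b a x) by rewrite (eb x) -/theta; ring.
  by rewrite /omega /force [b x ^+ 2 + _]addrC; ring.
Qed.

(** The dilation by 1 / kappa maps the rescaled constraint set to the original
    one and multiplies the energy by kappa^-2. *)
Lemma rescaled_minimizer (kappa : R) : 0 < kappa ->
  is_minimizer L m.*2 omega (kappa ^+ (m.*2 + 2) * upsilon)
    (fun x => kappa%:C * (a x +i* b x)).
Proof.
move=> k0; have [oa ob un Xu Bu O0 ea eb] := mp.
have [ca _ _] := oa; have [cb _ _] := ob.
have [[HH odd] _] := Xu.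
have [HHk Bk] := BenergyZ L0 omega kappa HH.
have Xk : Xset L m.*2 (kappa ^+ (m.*2 + 2) * upsilon) (fun x => kappa%:C * (a x +i* b x)).
  split.
    by split => //; apply: (ae_imp _ odd) => x /= ->; rewrite mulrN.
  rewrite -un addn2 -pnormZ// /pnorm; congr Rintegral; apply/funext => x.
  by rewrite -doubleS cmod_even /= !mul0r subr0 addr0.
split => //; apply/esym/inf_attained; first by exists (fun x => kappa%:C * (a x +i* b x)).
move=> _ [v Xv <-]; rewrite Bk Bu.
have [p [q [p' [q' [adm E]]]]] := admissible_of_Xset L0 omega Xv.
have := admissibleZ kappa^-1 adm.
rewrite addn2 mulrA -exprMn mulVf ?gt_eqF// expr1n mul1r => admk.
have := Omega_le_energy u0 admk.
have [op oq Lp' Lq' _ _ _ _ _] := adm.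
rewrite energyZ//; [|exact: odd_periodic_L2per|exact: odd_periodic_L2per].
rewrite -E exprVn ler_pdivlMl ?exprn_gt0//; lra.
Qed.

End Equation.
End Fix.
End Minimizer.

Unset Implicit Arguments.
Set Strict Implicit.
Set Printing Implicit Defensive.

Theorem proposition2p3 (R : realType) (L upsilon omega : R) (alpha : nat)
    (hL : 0 < L) (hupsilon : 0 < upsilon) (homega : 0 < omega)
    (halpha : (0 < alpha)%N) (halpha_even : ~~ odd alpha) :
  exists Psi : R -> R[i],
    [/\ Xset L alpha upsilon Psi,
        Benergy L omega Psi = Omega L alpha omega upsilon,
        2 * Omega L alpha omega upsilon = upsilon ->
          solves_equation alpha omega Psi &
        exists kappa : R,
          [/\ 0 < kappa,
              kappa ^+ alpha = 2 * Omega L alpha omega upsilon / upsilon,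
              is_minimizer L alpha omega (kappa ^+ (alpha + 2) * upsilon)
                (fun x => kappa%:C * Psi x) &
              solves_equation alpha omega (fun x => kappa%:C * Psi x)]].
Proof.
have [m aE] : exists m, alpha = m.*2.
  by exists alpha./2; rewrite -[LHS]odd_double_half (negbTE halpha_even) add0n.
have m0 : (0 < m)%N by move: halpha; rewrite aE double_gt0.
have s0 : 0 < Num.sqrt omega by rewrite sqrtr_gt0.
have oE : Num.sqrt omega ^+ 2 = omega by rewrite sqr_sqrtr// ltW.
have [a [b mp]] := minimizing_pair_exists m hL s0 hupsilon.
have theta0 : 0 < 2 * Omega L m.*2 omega upsilon / upsilon.
  by rewrite divr_gt0// mulr_gt0// -oE (mp_pos mp).
have [k k0 kE] := root_exists m.*2.-1 theta0.
rewrite prednK ?double_gt0// in kE.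
rewrite aE; exists (fun x => a x +i* b x); split.
- exact: mp_X mp.
- by rewrite -oE; exact: mp_B mp.
- move=> OE.
  have -> : (fun x => a x +i* b x) = (fun x => 1%:C * (a x +i* b x)).
    by apply/funext => x; rewrite mul1r.
  rewrite -oE; apply: (rescaled_solution hL s0 mp).
  by rewrite expr1n oE OE divff// gt_eqF.
- exists k; split => //.
  + by rewrite -oE; exact: (rescaled_minimizer hL s0 hupsilon mp).
  + by rewrite -oE; apply: (rescaled_solution hL s0 mp); rewrite oE.
Qed.
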